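(* Let $\phi:M^2\to N^3(c)$ be an oriented isometric immersion, let $\eta\in\mathbb C$ with $4\eta^2=c$, and let $$\mathscr B_c:=D^2+2\eta\,\omega D-2\eta H\omega+|A|^2-H^2-2c .$$ Suppose that on a connected open set $\Omega\subset M$ (a factorizing chart) $\mathscr B_c$ admits a mean-curvature-normalized factorization $$\mathscr B_c=\bigl(D+H+(\beta+2\eta)\omega\bigr)\bigl(D-H+\beta\,\omega\bigr),\qquad \beta\in C^\infty(\Omega,\mathbb C),$$ and put $s:=\beta+\eta$ and $\mathfrak D:=9c-4|A|^2$. Then on $\Omega$ $$\operatorname{grad}s=J\operatorname{grad}H,\qquad s^2=\frac{\mathfrak D}{4}=\frac{9c}{4}-|A|^2 .$$ Consequently $H$ and $s$ are harmonic. If $H$ is nonconstant on $\Omega$, then $s$ is real-valued, $c>0$, and $|A|^2\le\frac{9c}{4}$. In particular, there is no mean-curvature-normalized factorization with $H$ nonconstant when $c=0$ or $c<0$ (ambient space $\mathbb R^3$ or $\mathbb H^3$), and when $c<0$ this holds for every monic scalar--chiral factorization.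
   Context: $N^3(c)$ is an oriented Riemannian three-dimensional space form of constant sectional curvature $c\in\mathbb R$; $M^2$ is an oriented surface immersed with unit normal $\xi$ and induced metric $g$. The shape operator is $\nabla^N_X\xi=-A(X)$, $H=\frac12\operatorname{tr}A$, $|A|^2=\operatorname{tr}(A^2)$. Harmonic means annihilated by $\Delta=\operatorname{div}\operatorname{grad}$ of $g$. $\Sigma M$ is the complex spinor bundle of a spin structure on $M$; Clifford multiplication satisfies $X\cdot Y+Y\cdot X=-2g(X,Y)$. $\omega=e_1\cdot e_2$ for a positively oriented orthonormal frame, acting by Clifford multiplication, and $D\Psi=e_1\cdot\nabla_{e_1}\Psi+e_2\cdot\nabla_{e_2}\Psi$. $J$ is rotation by $+\pi/2$ on $TM$; for complex-valued functions $\operatorname{grad}$ and $J$ are extended complex-linearly. A monic scalar--chiral factorization on an open set is an operator identity $\mathscr B_c=(D+a+b\,\omega)(D+p+q\,\omega)$ with $a,b,p,q$ smooth complex-valued functions there. It is mean-curvature-normalized if $p=-H$, equivalently if it has the displayed form with $\beta$. *)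

(* Defs.v *)
From HB Require Import structures.
From mathcomp Require Import all_boot all_order all_algebra.
From mathcomp Require Import complex.
From mathcomp Require Import all_classical all_reals.
From mathcomp Require Import topology normedtype derive.
Set Implicit Arguments.
Unset Strict Implicit.
Unset Printing Implicit Defensive.
Import Order.TTheory GRing.Theory Num.Theory.
Import numFieldNormedType.Exports.
Local Open Scope classical_set_scope.
Local Open Scope ring_scope.
Local Open Scope complex_scope.

(* Conventions. Tensors are written classically: a field has one set of
   components per chart, subject to the transformation law. Tangent vectors are
   row vectors, so a differential (the library's Jacobian 'J), a change of
   coordinates or an endomorphism acts on them by right multiplication, and a
   bilinear form G is evaluated as u *m G *m v^T. The components in chart i
   carry no information outside the domain of i. *)

(* C^oo on the open set U: every iterated directional derivative is
   differentiable at every point of U. *)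
Definition smooth_on (R : realType) (n : nat) (V : normedModType R)
    (U : set 'rV[R]_n) (f : 'rV[R]_n -> V) : Prop :=
  forall (vs : seq 'rV[R]_n) (y : 'rV[R]_n), U y ->
    differentiable (foldr (fun v h => 'D_v h) f vs) y.

(* An oriented smooth n-manifold without boundary, given by an oriented atlas;
   param i is the inverse of the coordinate map coord i, and chart_at x is some
   chart around x. *)
Record manifold (R : realType) (n : nat) := Manifold {
  points :> topologicalType ;
  chart : Type ;
  dom : chart -> set points ;
  coord : chart -> points -> 'rV[R]_n ;
  param : chart -> 'rV[R]_n -> points ;
  chart_at : points -> chart ;
  mem_chart_at : forall x, dom (chart_at x) x ;
  dom_open : forall i, open (dom i) ;
  range_open : forall i, open (coord i @` dom i) ;
  coordK : forall i x, dom i x -> param i (coord i x) = x ;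
  coord_continuous : forall i x, dom i x -> {for x, continuous (coord i)} ;
  param_continuous : forall i y, (coord i @` dom i) y ->
    {for y, continuous (param i)} ;
  transition_smooth : forall i j,
    smooth_on (coord i @` (dom i `&` dom j)) (coord j \o param i) ;
  transition_oriented : forall i j x, dom i x -> dom j x ->
    0 < \det ('J (coord j \o param i) (coord i x)) ;
  points_hausdorff : hausdorff_space points ;
  points_second_countable : @second_countable points
}.
Arguments dom {R n} M i _ : rename.
Arguments coord {R n} M i _ : rename.
Arguments param {R n} M i _ : rename.
Arguments chart_at {R n} M x : rename.

Section Calculus.
Context {R : realType} {n : nat} (M : manifold R n).
Implicit Types (i j : chart M) (x : M) (W : set M).

(* Jacobian of the change of coordinates from chart i to chart j at x. *)
Definition transition i j x : 'M[R]_n :=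
  'J (coord M j \o param M i) (coord M i x).

Definition smooth_in (V : normedModType R) i W (f : M -> V) : Prop :=
  smooth_on (coord M i @` (dom M i `&` W)) (f \o param M i).

Definition smooth_fun W (f : M -> R) : Prop := forall i, smooth_in i W (f : M -> R^o).

Definition smooth_cfun W (f : M -> R[i]) : Prop :=
  smooth_fun W (fun x => complex.Re (f x)) /\ smooth_fun W (fun x => complex.Im (f x)).

(* Derivative at x of f along the tangent vector with components v in chart i. *)
Definition pdiff (V : normedModType R) i (f : M -> V) (v : 'rV[R]_n) x : V :=
  'D_v (f \o param M i) (coord M i x).

Definition cdiff i (f : M -> R[i]) (v : 'rV[R]_n) x : R[i] :=
  pdiff i (fun y => complex.Re (f y) : R^o) v x
  +i* pdiff i (fun y => complex.Im (f y) : R^o) v x.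

Definition vector_field W (X : chart M -> M -> 'rV[R]_n) : Prop :=
  (forall i, smooth_in i W (X i)) /\
  (forall i j x, W x -> dom M i x -> dom M j x ->
     X j x = X i x *m transition i j x).

Definition endomorphism_field (A : chart M -> M -> 'M[R]_n) : Prop :=
  (forall i, smooth_in i setT (A i)) /\
  (forall i j x, dom M i x -> dom M j x ->
     A i x *m transition i j x = transition i j x *m A j x).

End Calculus.

Definition bil (R : realType) (n : nat) (G : 'M[R]_n) (u v : 'rV[R]_n) : R :=
  (u *m G *m v^T) 0 0.

Record metric (R : realType) (n : nat) (M : manifold R n) := Metric {
  gram :> chart M -> M -> 'M[R]_n ;
  gram_smooth : forall i, smooth_in i setT (gram i) ;
  gram_sym : forall i x, dom M i x -> (gram i x)^T = gram i x ;
  gram_pos : forall i x (v : 'rV[R]_n), dom M i x -> v != 0 ->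
    0 < bil (gram i x) v v ;
  gram_law : forall i j x, dom M i x -> dom M j x ->
    gram i x = transition i j x *m gram j x *m (transition i j x)^T
}.

Section RiemannianGeometry.
Context {R : realType} {n : nat} {M : manifold R n} (g : metric M).
Implicit Types (i : chart M) (x : M) (u v w : 'rV[R]_n) (f : M -> R).

(* Components of Gamma(u, v), from the Koszul formula for coordinate fields:
   2 g(Gamma(u,v), w) = (d_u g)(v,w) + (d_v g)(u,w) - (d_w g)(u,v). *)
Definition christoffel i u v x : 'rV[R]_n :=
  2^-1 *: ((v *m pdiff i (g i) u x + u *m pdiff i (g i) v x
            - \row_k bil (pdiff i (g i) (delta_mx 0 k) x) u v)
           *m invmx (g i x)).

(* Levi-Civita derivative of the field with components Y along u, in chart i. *)
Definition nabla i u (Y : M -> 'rV[R]_n) x : 'rV[R]_n :=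
  pdiff i Y u x + christoffel i u (Y x) x.

(* R(u,v)w = nabla_u nabla_v w - nabla_v nabla_u w, where u, v, w are extended
   with constant components in chart i, so that [u, v] = 0. *)
Definition curvature i u v w x : 'rV[R]_n :=
  nabla i u (nabla i v (cst w)) x - nabla i v (nabla i u (cst w)) x.

Definition constant_sectional_curvature (c : R) : Prop :=
  forall i x u v, dom M i x ->
    let q := bil (g i x) in
    let area2 := q u u * q v v - q u v ^+ 2 in
    area2 != 0 -> q (curvature i u v v x) u / area2 = c.

Definition geodesic (gam : R -> M) : Prop :=
  continuous gam /\
  forall (t : R) i, dom M i (gam t) ->
    let y : R -> 'rV[R]_n := coord M i \o gam in
    [/\ derivable y t 1, derivable (derive1 y) t 1 &
        derive1 (derive1 y) t
          + christoffel i (derive1 y t) (derive1 y t) (gam t) = 0].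

Definition geodesically_complete : Prop :=
  forall i x v, dom M i x ->
    exists gam : R -> M,
      [/\ geodesic gam, gam 0 = x & derive1 (coord M i \o gam) 0 = v].

(* Complete connected Riemannian manifold of constant sectional curvature c. *)
Definition space_form (c : R) : Prop :=
  [/\ connected [set: M], geodesically_complete & constant_sectional_curvature c].

Definition grad i f x : 'rV[R]_n :=
  (\row_k pdiff i (f : M -> R^o) (delta_mx 0 k) x) *m invmx (g i x).

(* div X is the trace of u |-> nabla_u X. *)
Definition diverg i (X : M -> 'rV[R]_n) x : R :=
  \sum_(k < n) nabla i (delta_mx 0 k) X x 0 k.

Definition laplacian i f x : R := diverg i (grad i f) x.

Definition cgrad i (f : M -> R[i]) x : 'rV[R[i]]_n :=
  \row_k (grad i (fun y => complex.Re (f y)) x 0 k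
          +i* grad i (fun y => complex.Im (f y)) x 0 k).

Definition harmonic_on (W : set M) (f : M -> R) : Prop :=
  forall i x, W x -> dom M i x -> laplacian i f x = 0.

Definition charmonic_on (W : set M) (f : M -> R[i]) : Prop :=
  harmonic_on W (fun x => complex.Re (f x)) /\
  harmonic_on W (fun x => complex.Im (f x)).

End RiemannianGeometry.

Section Hypersurface.
Context {R : realType} {M : manifold R 2} {N : manifold R 3}.
Context (g : metric M) (gN : metric N) (phi : M -> N).
Implicit Types (i : chart M) (k : chart N) (x : M).

Definition dmap i k x : 'M[R]_(2, 3) :=
  'J (coord N k \o phi \o param M i) (coord M i x).

(* Injectivity of the differential follows from positivity of the two metrics. *)
Definition isometric_immersion : Prop :=
  [/\ continuous phi,
      forall i k, smooth_in i (phi @^-1` dom N k) (coord N k \o phi) &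
      forall i k x, dom M i x -> dom N k (phi x) ->
        g i x = dmap i k x *m gN k (phi x) *m (dmap i k x)^T].

(* xi k x holds the components of xi(x), a tangent vector of N at phi x, in the
   chart k of N. *)
Definition unit_normal (xi : chart N -> M -> 'rV[R]_3) : Prop :=
  [/\ forall i k, smooth_in i (phi @^-1` dom N k) (xi k),
      forall k l x, dom N k (phi x) -> dom N l (phi x) ->
        xi l x = xi k x *m transition k l (phi x),
      forall k x, dom N k (phi x) -> bil (gN k (phi x)) (xi k x) (xi k x) = 1 &
      forall i k x (v : 'rV[R]_2), dom M i x -> dom N k (phi x) ->
        bil (gN k (phi x)) (v *m dmap i k x) (xi k x) = 0].

(* nabla^N_v xi = - dphi (A v), with nabla^N pulled back along phi. *)
Definition shape_operator (xi : chart N -> M -> 'rV[R]_3)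
    (A : chart M -> M -> 'M[R]_2) : Prop :=
  endomorphism_field A /\
  forall i k x (v : 'rV[R]_2), dom M i x -> dom N k (phi x) ->
    pdiff i (xi k) v x
      + christoffel gN k (v *m dmap i k x) (xi k x) (phi x)
    = - (v *m A i x *m dmap i k x).

(* Traces do not depend on the chart. *)
Definition mean_curvature (A : chart M -> M -> 'M[R]_2) x : R :=
  \tr (A (chart_at M x) x) / 2.

Definition shape_norm2 (A : chart M -> M -> 'M[R]_2) x : R :=
  \tr (A (chart_at M x) x *m A (chart_at M x) x).

End Hypersurface.

(* Clifford multiplication by e_1 (k = 0) and e_2 (k = 1) on C^2: the complex
   irreducible representation, unique up to isomorphism. *)
Definition cliff (R : realType) (k : 'I_2) : 'M[R[i]]_2 :=
  if k == 0 then \matrix_(r, s) (if r == s then 0 else if r == 0 then -1 else 1)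
  else \matrix_(r, s) (if r == s then 0 else 'i).

Lemma cliff_rel (R : realType) (k l : 'I_2) :
  cliff R k *m cliff R l + cliff R l *m cliff R k
  = (- ((k == l)%:R *+ 2))%:M.
Proof.
apply/matrixP => r s; rewrite !mxE !big_ord_recl !big_ord0 /cliff.
case: k => [[|[|//]] ?]; case: l => [[|[|//]] ?];
  case: r => [[|[|//]] ?]; case: s => [[|[|//]] ?];
  by rewrite !mxE /= ?mulr1n ?mulr0n; simpc; rewrite ?addNr.
Qed.

Definition vol_mx (R : realType) : 'M[R[i]]_2 := cliff R 0 *m cliff R 1.

(* The element p + q e_1 e_2 of Spin(2), with p^2 + q^2 = 1, is encoded by the
   complex number z = p + i q, and acts on C^2 by spin_mx z. Under
   the covering Spin(2) -> SO(2) it goes to the rotation by twice its argument,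
   z e_1 z^-1 = Re(z^2) e_1 + Im(z^2) e_2. *)
Definition spin_mx (R : realType) (z : R[i]) : 'M[R[i]]_2 :=
  (complex.Re z)%:C%:M + (complex.Im z)%:C *: vol_mx R.

(* A spin structure as a lift to Spin(2) of the cocycle relating local
   positively oriented orthonormal frames (e_1, e_2) = (frame a 0, frame a 1). *)
Record spin_structure (R : realType) (M : manifold R 2) (g : metric M) :=
  SpinStructure {
  gauge : Type ;
  gdom : gauge -> set M ;
  frame : gauge -> 'I_2 -> chart M -> M -> 'rV[R]_2 ;
  spin_lift : gauge -> gauge -> M -> R[i] ;
  gdom_open : forall a, open (gdom a) ;
  gdom_cover : forall x, exists a, gdom a x ;
  frame_field : forall a k, vector_field (gdom a) (frame a k) ;
  frame_orthonormal : forall a k l i x, gdom a x -> dom M i x ->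
    bil (g i x) (frame a k i x) (frame a l i x) = (k == l)%:R ;
  frame_oriented : forall a i x, gdom a x -> dom M i x ->
    0 < \det (\matrix_(k < 2) frame a k i x) ;
  spin_lift_smooth : forall a b, smooth_cfun (gdom a `&` gdom b) (spin_lift a b) ;
  spin_lift_unit : forall a b x, gdom a x -> gdom b x -> `|spin_lift a b x| = 1 ;
  spin_lift_frame : forall a b i x, gdom a x -> gdom b x -> dom M i x ->
    let z2 := spin_lift a b x ^+ 2 in
    frame b 0 i x = complex.Re z2 *: frame a 0 i x + complex.Im z2 *: frame a 1 i x /\
    frame b 1 i x = - complex.Im z2 *: frame a 0 i x + complex.Re z2 *: frame a 1 i x ;
  spin_lift_cocycle : forall a b d x, gdom a x -> gdom b x -> gdom d x ->
    spin_lift a b x * spin_lift b d x = spin_lift a d x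
}.

Section SpinorBundle.
Context {R : realType} {M : manifold R 2} {g : metric M} (S : spin_structure g).

(* A spinor field, given by its components in each gauge. *)
Definition spinors := gauge S -> M -> 'cV[R[i]]_2.

Implicit Types (i : chart M) (a : gauge S) (x : M) (psi : spinors) (W : set M).

(* Smooth sections of the spinor bundle over the open set W. *)
Definition spinor_section W psi : Prop :=
  (forall a (r : 'I_2), smooth_cfun (W `&` gdom a) (fun x => psi a x r 0)) /\
  (forall a b x, W x -> gdom a x -> gdom b x ->
     psi a x = spin_mx (spin_lift a b x) *m psi b x).

(* nabla_v psi = v(psi) + (1/2) g(nabla_v e_1, e_2) e_1 . e_2 . psi
   in the gauge a, with v given by its components in chart i. *)
Definition spin_nabla i psi a (v : 'rV[R]_2) x : 'cV[R[i]]_2 :=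
  (\col_r cdiff i (fun y => psi a y r 0) v x)
  + (2^-1 * bil (g i x) (nabla g i v (frame a 0 i) x) (frame a 1 i x))%:C
      *: (vol_mx R *m psi a x).

(* The Dirac operator computed in chart i; all charts around x give the same
   value at x. *)
Definition dirac i psi : spinors := fun a x =>
  \sum_(k < 2) cliff R k *m spin_nabla i psi a (frame a k i x) x.

Definition omega psi : spinors := fun a x => vol_mx R *m psi a x.

(* (D + a + b omega) psi, with a = f and b = h. *)
Definition scalar_chiral i (f h : M -> R[i]) psi : spinors := fun a x =>
  dirac i psi a x + f x *: psi a x + h x *: omega psi a x.

(* B_c psi, where H and nA stand for H and |A|^2. *)
Definition Bop i (c : R) (eta : R[i]) (H nA : M -> R) psi : spinors :=
  fun a x =>
    dirac i (dirac i psi) a x + (2 * eta) *: omega (dirac i psi) a x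
    - (2 * eta * (H x)%:C) *: omega psi a x
    + (nA x - H x ^+ 2 - 2 * c)%:C *: psi a x.

(* B_c = (D + a + b omega) (D + p + q omega) as operators on C^oo(W, Sigma M),
   with a, b, p, q = f, h, p, q. *)
Definition monic_factorization W c eta (H nA : M -> R) (f h p q : M -> R[i]) : Prop :=
  [/\ smooth_cfun W f, smooth_cfun W h, smooth_cfun W p & smooth_cfun W q] /\
  forall psi, spinor_section W psi ->
  forall i a x, W x -> dom M i x -> gdom a x ->
    Bop i c eta H nA psi a x
    = scalar_chiral i f h (scalar_chiral i p q psi) a x.

Definition mean_curvature_normalized W (H : M -> R) (p : M -> R[i]) : Prop :=
  forall x, W x -> p x = - (H x)%:C.

End SpinorBundle.

(* Rotation by + pi/2 in an oriented chart: v |-> v *m quarter_turn i x, the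
   endomorphism J with g(Ju, v) = area(u, v) = sqrt(det g) (u_1 v_2 - u_2 v_1). *)
Definition quarter_turn (R : realType) (M : manifold R 2) (g : metric M)
    (i : chart M) (x : M) : 'M[R]_2 :=
  Num.sqrt (\det (g i x)) *:
    ((\matrix_(k, l) ((k < l)%N%:R - (l < k)%N%:R)) *m invmx (g i x)).

Lemma gram_unit (R : realType) (n : nat) (M : manifold R n) (g : metric M)
    (i : chart M) (x : M) : dom M i x -> g i x \in unitmx.
Proof.
move=> ix; rewrite -row_free_unit -kermx_eq0; apply/rowV0P => v /sub_kermxP vG0.
apply/eqP; apply: contraT => /(gram_pos g ix).
by rewrite /bil vG0 mul0mx mxE ltxx.
Qed.

Lemma quarter_turnE (R : realType) (M : manifold R 2) (g : metric M)
    (i : chart M) (x : M) (u v : 'rV[R]_2) : dom M i x ->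
  bil (g i x) (u *m quarter_turn g i x) v
  = Num.sqrt (\det (g i x)) * (u 0 0 * v 0 1 - u 0 1 * v 0 0).
Proof.
move=> ix; rewrite /bil /quarter_turn -scalemxAr mulmxA -!scalemxAl.
rewrite mulmxKV ?gram_unit// mxE; congr (_ * _).
rewrite !mxE !big_ord_recl !big_ord0 !mxE !big_ord_recl !big_ord0 !mxE /=.
have -> : lift ord0 ord0 = 1 :> 'I_2 by apply/val_inj.
have -> : 0 = ord0 :> 'I_2 by apply/val_inj.
by rewrite !(subrr, subr0, sub0r, mulr0, mulr1, mulrN1, addr0, add0r, mulNr) addrC.
Qed.

Definition nonconstant_on (R : realType) (T : Type) (W : set T) (H : T -> R) : Prop :=
  exists x y, [/\ W x, W y & H x <> H y].

(* Main.v *)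
(* Subtracting D^2 psi from the two sides of the factorization leaves a first-order
   identity. Testing it at a point on spinors which vanish there with prescribed
   derivative, and then on spinors with prescribed value, gives a = -p, b = q + 2 eta,
   eta (p + H) = 0, grad p . + grad q . omega = 0 (that is, grad q = - J grad p) and
   p^2 + q^2 + 2 eta q = H^2 + 2 c - |A|^2. For p = -H and s = q + eta the last two
   equations read grad s = J grad H and s^2 = 9 c / 4 - |A|^2, and div J grad = 0 makes
   H and s harmonic. As H and s^2 are real, Im s is constant and Re s Im s = 0; if
   Im s <> 0 or Re s = 0 identically, then grad H = 0 and H is constant. Otherwise s is
   real, so 0 <= |A|^2 <= 9 c / 4, the first inequality because A is self-adjoint.

   Cutting a local spinor off to a global section requires a smooth bump function in a
   chart, built here from exp (- 1 / t). *)

Require Import Defs.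
From mathcomp Require Import all_boot all_order all_algebra.
From mathcomp Require Import complex.
From mathcomp Require Import all_classical all_reals.
From mathcomp Require Import topology normedtype derive.
From mathcomp Require Import landau sequences exp realfun ring lra.
Import Order.TTheory GRing.Theory Num.Theory.
Import numFieldNormedType.Exports.
Local Open Scope classical_set_scope.
Local Open Scope ring_scope.
Local Open Scope complex_scope.
(* [vector.coord] shadows the chart maps. *)
Local Notation coord := Defs.coord.

Set Implicit Arguments.
Unset Strict Implicit.
Unset Printing Implicit Defensive.

(** * Smooth functions of several real variables *)

(** The factorization is an identity between operators on sections over all of [Omega], while the
    information wanted is pointwise. A test section must be given in every gauge and be smooth
    outside the chart it lives in as well; compact support and the Hausdorff axiom ensure this. As
    1, e_1, e_2 and omega form a basis of the complex 2 by 2 matrices, each matrix identity so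
    obtained splits into scalar ones. The constant 9/4 comes from completing the square: eta^2 = c/4
    is added to 2 c.

    That div J grad vanishes is checked in coordinates. If P is the matrix of a positively oriented
    orthonormal frame, then det P = 1 / sqrt(det g) and J grad f has components det P (- d_2 f, d_1
    f). The derivatives of det P cancel the trace of the Christoffel symbols, and the second
    derivatives of f cancel by symmetry. The same symmetry makes the shape operator self-adjoint.

    Smoothness is differentiability of all iterated directional derivatives, so closure under
    products and under composition with the flat functions is proved for a class of functions that
    is itself stable under derivatives. *)

Lemma near_eq_differentiable (R : numFieldType) (V W : normedModType R)
    (f h : V -> W) (y : V) :
  {near y, f =1 h} -> differentiable f y -> differentiable h y.
Proof.
(* The difference vanishes near [y], hence is little-o of everything and has differential 0. *)
move=> fh df; pose k := h - f.
have -> : h = f + k by rewrite /k addrC subrK.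
apply: differentiableD => //.
have ky0 : k y = 0.
  by apply/eqP; rewrite subr_eq0; apply/eqP; rewrite (nbhs_singleton fh).
have c0 : continuous (\0 : V -> W) by move=> z; apply: cvg_cst.
have kE : k \o shift y = cst (k y) + (\0 : {linear V -> W}) +o_ 0 id.
  apply/eqaddoP => e e0.
  have : \forall z \near (0 : V), f (z + y) = h (z + y).
    by move/nbhs0P : fh; apply: filterS => z /=; rewrite addrC.
  apply: filterS => z fhz.
  by rewrite ky0 /k !fctE /= fhz addr0 !subrr normr0 mulr_ge0 // ltW.
have dk : 'd k y = (\0 : {linear V -> W}) :> (V -> W) by apply: diff_unique.
by apply/diff_locallyP; rewrite dk.
Qed.

(** * The flat functions t^-k exp(-1/t) *)

Section Flat.
Context {R : realType}.
Implicit Types t : R.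

(** The power in front makes the family closed under differentiation up to linear combinations, so
    that smoothness of exp(-1/t) needs first derivatives only. *)
Definition flat (k : nat) t : R :=
  if 0 < t then t^-1 ^+ k * expR (- t^-1) else 0.

Lemma flat_le0 k t : t <= 0 -> flat k t = 0.
Proof. by rewrite /flat leNgt => /negbTE ->. Qed.

Lemma flat_gt0 k t : 0 < t -> 0 < flat k t.
Proof. by move=> t0; rewrite /flat t0 mulr_gt0 ?expR_gt0 ?exprn_gt0 ?invr_gt0. Qed.

Lemma flat_ge0 k t : 0 <= flat k t.
Proof.
by have [t0|t0] := leP t 0; [rewrite flat_le0 | rewrite ltW // flat_gt0].
Qed.

(** With u = 1/t, the exponential exceeds the single term u^(k+2)/(k+2)! of its series. A quadratic
    bound is what makes the difference quotient at 0 tend to 0. *)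
Lemma flat_le_square k t : flat k t <= k.+2`!%:R * t ^+ 2.
Proof.
have [t0|t0] := leP t 0; first by rewrite flat_le0 // mulr_ge0 ?sqr_ge0.
have u0 : 0 < t^-1 by rewrite invr_gt0.
rewrite /flat t0 expRN ler_pdivrMr ?expR_gt0 //.
have := expR_ge1Dxn k.+1 (ltW u0); move: u0; rewrite -[in t ^+ 2](invrK t).
move: (t^-1) => u u0; set e := expR _.
set N : R := _`!%:R => le_e.
have N0 : 0 < N by rewrite ltr0n fact_gt0.


have un0 : u != 0 by rewrite gt_eqF.
have -> : u ^+ k = N * u ^- 2 * (u ^+ k.+2 / N).
  rewrite -[in RHS](addn2 k) exprD; by field; rewrite un0 gt_eqF.
rewrite exprVn; apply: ler_wpM2l; first by rewrite mulr_ge0 ?invr_ge0 ?exprn_ge0 ?ltW //.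
by apply: le_trans le_e; rewrite lerDr.
Qed.

Lemma flat_quotient_cvg0 k :
  (fun h : R => h^-1 *: ((flat k \o shift 0) h%:A - flat k 0)) @ 0^' --> (0 : R^o).
Proof.
set N : R := k.+2`!%:R.
have N0 : 0 < N by rewrite ltr0n fact_gt0.
apply/cvgrPdist_le => e e0; near=> h.
have h0 : h != 0 by near: h; exact: nbhs_dnbhs_neq.
rewrite sub0r normrN (flat_le0 k (lexx 0)) subr0 /= addr0 [h%:A]mulr1.
rewrite normrM normfV ler_pdivrMl ?normr_gt0 // ger0_norm ?flat_ge0 //.
apply: le_trans (flat_le_square k h) _.
rewrite -real_normK ?num_real // expr2 mulrCA ler_wpM2l //.
rewrite mulrC -ler_pdivlMr //.
by near: h; apply: dnbhs0_le; rewrite divr_gt0.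
Unshelve. all: by end_near. Qed.

Lemma is_derive_flat k t :
  is_derive t 1 (flat k : R -> R^o) (flat k.+2 t - k%:R * flat k.+1 t).
Proof.
have [t0|t0|->] := ltrgtP t 0.
- rewrite !flat_le0 ?ltW // mulr0 subr0.
  apply: (@near_eq_is_derive _ _ _ (cst 0)).
  have : \near t, t < 0 by exact: lt_nbhsl.
  by apply: filterS => z z0; rewrite flat_le0 // ltW.
- apply: (@near_eq_is_derive _ _ _ (fun z : R => z^-1 ^+ k * expR (- z^-1) : R^o)).
    have : \near t, 0 < t by exact: lt_nbhsr.
    by apply: filterS => z z0; rewrite /flat z0.
  have tn0 : t != 0 by rewrite gt_eqF.
  have dV : is_derive t 1 (fun z : R => z^-1) (- t ^- 2).
    have := @is_deriveV R id t 1 1 tn0 (is_derive_id _ _).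
    by rewrite /= [_ *: _]mulr1.
  have dE := @is_derive1_comp R expR (fun z : R => - z^-1) t _ _
    (is_derive_expR _) (is_deriveN dV).
  have := is_deriveM (is_deriveX k dV) dE.
  rewrite (_ : _ * _ = (fun z : R => z^-1 ^+ k * expR (- z^-1))); last first.
    by apply/funext => z; rewrite !fctE.
  move=> dF; apply: (@DeriveDef _ _ _ _ _ _ _ (@ex_derive _ _ _ _ _ _ _ dF)).
  rewrite derive_val; rewrite /flat t0 /GRing.scale /=.
  rewrite -exprVn opprK; set e := expR _; set u := t^-1.
  case: k {dF} => [|k]; first by rewrite !mul0r !fctE !expr0; ring.
  by rewrite !fctE /= !exprS expr0 -/u; move: (_%:R) (u ^+ k) => w z; ring.
(* At the origin neither one-sided formula holds in a neighbourhood; the quadratic bound gives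
   derivative 0. *)
- rewrite !flat_le0 // mulr0 subr0.
  apply: DeriveDef; [apply/cvg_ex; exists 0|apply: cvg_lim => //];
    exact: flat_quotient_cvg0.
Qed.


End Flat.

(** * Smoothness through iterated directional derivatives *)

Section Smooth.
Context {R : realType} {n : nat}.
Local Notation E := 'rV[R]_n.
Implicit Types (y v : E) (U : set E).

Lemma foldr_derive_near (V : normedModType R) (f h : E -> V) vs y :
  {near y, f =1 h} ->
  {near y, foldr (fun v k => 'D_v k) f vs =1 foldr (fun v k => 'D_v k) h vs}.
Proof.
move=> fh; elim: vs => //= v vs /near_join; apply: filterS => z fhz.
exact: near_eq_derive.
Qed.

Lemma smooth_on_derive (V : normedModType R) U (f : E -> V) v :
  smooth_on U f -> smooth_on U ('D_v f).
Proof. by move=> sf vs y Uy; have := sf (rcons vs v) y Uy; rewrite foldr_rcons. Qed.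

Lemma smooth_on_differentiable (V : normedModType R) U (f : E -> V) y :
  smooth_on U f -> U y -> differentiable f y.
Proof. by move=> sf Uy; exact: (sf [::] y Uy). Qed.

Lemma smooth_on_eq (V : normedModType R) U (f h : E -> V) :
  open U -> (forall y, U y -> f y = h y) -> smooth_on U f -> smooth_on U h.
Proof.
move=> oU fh sf vs y Uy; apply: near_eq_differentiable (sf vs y Uy).
by apply: foldr_derive_near; apply: filterS fh _; exact: open_nbhs_nbhs.
Qed.

Lemma smooth_on_sub (V : normedModType R) U U' (f : E -> V) :
  U `<=` U' -> smooth_on U' f -> smooth_on U f.
Proof. by move=> UU' sf vs y /UU'; exact: sf. Qed.

(* Smoothness of sums, products and compositions with [flat] at once: this class
   is stable under directional derivatives. *)
Inductive flat_algebra U : (E -> R^o) -> Prop :=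
| flat_algebra_smooth f : smooth_on U f -> flat_algebra U f
| flat_algebra_flat k (q : E -> R^o) : smooth_on U q ->
    flat_algebra U (fun y => flat k (q y))
| flat_algebra_add f h : flat_algebra U f -> flat_algebra U h ->
    flat_algebra U (fun y => f y + h y)
| flat_algebra_mul f h : flat_algebra U f -> flat_algebra U h ->
    flat_algebra U (fun y => f y * h y)
| flat_algebra_eq f h : (forall y, U y -> f y = h y) -> flat_algebra U f ->
    flat_algebra U h.

Lemma smooth_on_cst (V : normedModType R) U (c : V) : smooth_on U (cst c : E -> V).
Proof.
suff H vs : exists c' : V, foldr (fun v k => 'D_v k) (cst c : E -> V) vs = cst c'.
  by move=> vs y _; have [c' ->] := H vs; exact: differentiable_cst.
elim: vs => [|v vs [c' ih]]; first by exists c.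
by exists 0 => /=; rewrite ih; apply/funext => y; rewrite derive_cst.
Qed.

Lemma is_derive_flat_comp k (q : E -> R^o) y v : differentiable q y ->
  is_derive y v (fun z => flat k (q z) : R^o)
    ((flat k.+2 (q y) - k%:R * flat k.+1 (q y)) * 'D_v q y).
Proof.
move=> dq; have [fl fE] := is_derive_flat k (q y).
have dfl : differentiable (flat k : R -> R^o) (q y) by apply/derivable1_diffP.
have dc : differentiable ((flat k : R -> R^o) \o q) y.
  exact: differentiable_comp.
apply: DeriveDef; first exact: diff_derivable.
rewrite deriveE // diff_comp //= diff1E // derive1E fE -deriveE //.
by rewrite /GRing.scale /= mulrC.
Qed.

Lemma flat_algebra_differentiable U f y :
  open U -> flat_algebra U f -> U y -> differentiable f y.
Proof.
move=> oU + Uy; elim=> {f} [f sf|k q sq|f h _ df _ dh|f h _ df _ dh|f h fh _ df].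
- exact: smooth_on_differentiable sf Uy.
- have [fl _] := is_derive_flat k (q y).
  have dfl : differentiable (flat k : R -> R^o) (q y) by apply/derivable1_diffP.
  apply: (@differentiable_comp _ _ _ _ q (flat k : R -> R^o)) => //.
  exact: smooth_on_differentiable sq Uy.
- exact: differentiableD.
- exact: differentiableM.
- apply: near_eq_differentiable df.
  by apply: filterS fh _; exact: open_nbhs_nbhs.
Qed.

Lemma flat_algebra_derive U f v :
  open U -> flat_algebra U f -> flat_algebra U ('D_v f).
Proof.
move=> oU; elim=> {f} [f sf|k q sq|f h fa df ha dh|f h fa df ha dh|f h fh _ df].
- exact/flat_algebra_smooth/smooth_on_derive.
- apply: (@flat_algebra_eq _
    (fun y => (flat k.+2 (q y) + (- k%:R) * flat k.+1 (q y)) * 'D_v q y)).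
    move=> y Uy; have dq := smooth_on_differentiable sq Uy.
    by have [_ ->] := is_derive_flat_comp k v dq; rewrite mulNr.
  apply: flat_algebra_mul; last exact/flat_algebra_smooth/smooth_on_derive.
  apply: flat_algebra_add; first exact: flat_algebra_flat.
  apply: flat_algebra_mul; last exact: flat_algebra_flat.
  exact/flat_algebra_smooth/smooth_on_cst.
- apply: (@flat_algebra_eq _ (fun y => 'D_v f y + 'D_v h y)).
    move=> y Uy; rewrite -[RHS]/('D_v (f + h) y) deriveD //;
      exact/diff_derivable/(@flat_algebra_differentiable U).
  exact: flat_algebra_add.
- apply: (@flat_algebra_eq _ (fun y => f y * 'D_v h y + h y * 'D_v f y)).
    move=> y Uy; rewrite -[RHS]/('D_v ((f : E -> R) * h) y) deriveM //;
      exact/diff_derivable/(@flat_algebra_differentiable U).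
  by apply: flat_algebra_add; exact: flat_algebra_mul.
- apply: flat_algebra_eq df => y Uy; apply: near_eq_derive.
  by apply: filterS fh _; exact: open_nbhs_nbhs.
Qed.

Lemma flat_algebra_smooth_on U f : open U -> flat_algebra U f -> smooth_on U f.
Proof.
move=> oU fa vs y Uy; apply: (@flat_algebra_differentiable U) => //.
by elim: vs => //= v vs; exact: flat_algebra_derive.
Qed.

(** Hiding the open set lets functions smooth on different neighbourhoods be combined without
    tracking domains. *)
Definition smooth_at y (f : E -> R^o) := exists U, [/\ open U, U y & smooth_on U f].

End Smooth.

(** * Symmetry of second derivatives *)

Section Schwarz.
Context {R : realType} {V : normedModType R}.
Implicit Types (u v y : V) (f : V -> R^o).

Let second_difference f y u v (h : R) : R :=
  (f (h *: u + (h *: v + y)) - f (h *: u + y)) - (f (h *: v + y) - f y).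

Lemma derivative_along_line f u z (t : R) : differentiable f (t *: u + z) ->
  is_derive t 1 (fun s : R => f (s *: u + z) : R^o) ('D_u f (t *: u + z)).
Proof.
move=> df; pose L := fun s : R => s *: u + z.
have dL : is_diff t L ( *:%R^~ u).
  rewrite (_ : L = ( *:%R^~ u) + cst z); last by apply/funext.
  by apply: is_diff_eq; rewrite addr0.
have dfL : differentiable (f \o L) t by apply: differentiable_comp.
apply: DeriveDef; first by apply/derivable1_diffP.
rewrite deriveE // diff_comp //= deriveE //.
by rewrite diff_val scale1r.
Qed.

(** The second difference is an increment along [u] of t |-> f(t u + h v + y) - f(t u + y). The mean
    value theorem turns it into h times a difference of two values of ['D_u f], and both values are
    compared with the first-order expansion of ['D_u f] at [y]. *)
Lemma second_difference_estimate f y u v (e : R) : 0 < e ->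
  (\forall z \near y, differentiable f z) -> differentiable ('D_u f) y ->
  \forall h \near 0^'+,
    `|second_difference f y u v h - h ^+ 2 * 'D_v ('D_u f) y| <= e * h ^+ 2.
Proof.
move=> e0 df dA; pose A := 'D_u f : V -> R^o.
(* The two expansions are taken at displacements of norm at most h (|u| + |v|) and h |u|; [K] bounds
   the sum over h, and the 1 keeps it positive. *)
pose K := 2 * `|u| + `|v| + 1.
have K0 : 0 < K by rewrite ltr_wpDl // addr_ge0 // mulr_ge0.
have eK0 : 0 < e / K by rewrite divr_gt0.
have /eqaddoP/(_ _ eK0)/nbhs_ballP[d1 /= d10 hd1] := diff_locally dA.
move/nbhs_ballP : df => [d2 /= d20 hd2].
pose d := Num.min d1 d2.
have d0 : 0 < d by rewrite lt_min d10.
have small w : `|w| < d -> differentiable f (w + y) /\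
    `|A (w + y) - A y - 'd A y w| <= e / K * `|w|.
  rewrite lt_min => /andP[w1 w2]; split.
    by apply: hd2; rewrite -ball_normE /ball_/= opprD addrCA subrr addr0 normrN.
  have := hd1 w; rewrite -ball_normE /ball_/= sub0r normrN => /(_ w1).
  by rewrite !fctE /= opprD addrA.
near=> h.
have h0 : 0 < h by near: h; exact: nbhs_right_gt.
have hd : h * K < d.
  by rewrite -ltr_pdivlMr //; near: h; apply: nbhs_right_lt; rewrite divr_gt0.
have bnd (s t : R) : 0 <= s <= h -> 0 <= t <= h ->
    `|s *: u + t *: v| <= h * (`|u| + `|v|).
  move=> /andP[s0 sh] /andP[t0 th]; rewrite mulrDr.
  apply: le_trans (ler_normD _ _) _; rewrite !normrZ !ger0_norm //.
  by apply: lerD; exact: ler_wpM2r.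
have bd (s t : R) : 0 <= s <= h -> 0 <= t <= h -> `|s *: u + t *: v| < d.
  move=> hs ht; apply: le_lt_trans (bnd _ _ hs ht) _; apply: le_lt_trans hd.
  apply: ler_wpM2l; first exact: ltW.
  by rewrite /K; have := normr_ge0 u; lra.
have hh : 0 <= h <= h by rewrite lexx ltW.
have h00 : (0 : R) <= 0 <= h by rewrite lexx ltW.
pose g := fun t : R => f (t *: u + (h *: v + y)) - f (t *: u + y).
have dg t : 0 <= t <= h ->
    is_derive t 1 (g : R -> R^o) (A (t *: u + (h *: v + y)) - A (t *: u + y)).
  move=> ht; apply: is_deriveB; apply: derivative_along_line.
    by rewrite addrA; apply: (small _ (bd _ _ ht hh)).1.
  by have := (small _ (bd _ _ ht h00)).1; rewrite scale0r addr0.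
have [] := @MVT R g (fun t => A (t *: u + (h *: v + y)) - A (t *: u + y)) 0 h h0.
- by move=> t; rewrite in_itv /= => /andP[t0 th]; apply: dg; rewrite !ltW.
- apply: derivable_within_continuous => t; rewrite in_itv /= => ht.
  by have [] := dg t ht.
move=> c; rewrite in_itv /= => /andP[c0 ch]; rewrite subr0 => gE.
have hc : 0 <= c <= h by rewrite !ltW.
have -> : second_difference f y u v h = g h - g 0.
  by rewrite /g /second_difference !scale0r !add0r.
have [_ e1] := small _ (bd _ _ hc hh); have [_ e2] := small _ (bd _ _ hc h00).
pose du : R := 'd A y u; pose dv : R := 'd A y v.
have dE1 : 'd A y (c *: u + h *: v) = c * du + h * dv by rewrite linearD !linearZ.
have dE2 : 'd A y (c *: u + 0 *: v) = c * du by rewrite scale0r addr0 linearZ.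
rewrite gE deriveE // -/A -/dv; move: e1 e2.
rewrite dE1 dE2 scale0r addr0 -[c *: u + h *: v + y]addrA.
move: (A (c *: u + (h *: v + y))) (A (c *: u + y)) (A y) => a1 a2 a0 e1 e2.
have E : (a1 - a2) * h - h ^+ 2 * dv = h * ((a1 - a0 - (c * du + h * dv)) -
   (a2 - a0 - c * du)) :> R by ring.
rewrite [X in `|X|]E.
rewrite normrM (gtr0_norm h0) expr2 mulrCA; apply: ler_wpM2l; first exact: ltW.
apply: le_trans (ler_normB _ _) _; apply: le_trans (lerD e1 e2) _.
rewrite -mulrDr mulrAC -mulrA ler_wpM2l ?(ltW e0) //.
rewrite ler_pdivrMr //; have := bnd _ _ hc h00; rewrite scale0r addr0.
have := bnd _ _ hc hh.
have : `|c *: u| <= h * `|u|.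
  by rewrite normrZ ger0_norm ?(ltW c0) //; apply: ler_wpM2r => //; exact: ltW.
by rewrite /K; nra.
Unshelve. all: by end_near. Qed.

(** The second difference is symmetric in [u] and [v], so both mixed derivatives approximate the
    same number divided by h^2. Differentiability of the first derivatives at the point suffices;
    continuity of the second ones is not assumed. *)
Lemma derive_swap f y u v :
  (\forall z \near y, differentiable f z) ->
  differentiable ('D_u f) y -> differentiable ('D_v f) y ->
  'D_v ('D_u f) y = 'D_u ('D_v f) y.
Proof.
move=> df dA dB; apply/eqP; rewrite -subr_eq0 -normr_le0.
apply/ler_addgt0Pl => e e0; rewrite addr0.
have e20 : 0 < e / 2 by rewrite divr_gt0.
have [h [h0 h1 h2]] : exists h : R, [/\ 0 < h,
    `|second_difference f y u v h - h ^+ 2 * 'D_v ('D_u f) y| <= e / 2 * h ^+ 2 &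
    `|second_difference f y v u h - h ^+ 2 * 'D_u ('D_v f) y| <= e / 2 * h ^+ 2].
  have h1 := second_difference_estimate v e20 df dA.
  have h2 := second_difference_estimate u e20 df dB.
  have h0 : \forall h \near (0 : R)^'+, 0 < h by exact: nbhs_right_gt.
  have [h [hp [hu hv]]] := @filter_ex _ (0 : R)^'+ _ _ (filterI h0 (filterI h1 h2)).
  by exists h; split; [exact: hp | exact: hu | exact: hv].
have sE : second_difference f y v u h = second_difference f y u v h.
  rewrite /second_difference [h *: v + (_ + _)]addrCA !opprB.
  by rewrite addrACA [RHS]addrACA [X in _ + X]addrC.
have hh0 : 0 < h ^+ 2 by rewrite exprn_gt0.
rewrite -(ler_pM2l hh0) -{1}(gtr0_norm hh0) -normrM.
move: h1 h2; rewrite sE; move: (second_difference _ _ _ _ _) => s.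
move: ('D_v ('D_u f) y) ('D_u ('D_v f) y) => a b h1 h2.
have E : h ^+ 2 * (a - b) = (s - h ^+ 2 * b) - (s - h ^+ 2 * a) :> R by ring.
rewrite [X in `|X|]E.
apply: le_trans (ler_normB _ _) _; apply: le_trans (lerD h2 h1) _.
by rewrite -mulrDl -splitr mulrC.
Qed.

End Schwarz.

(** * Smoothness at a point, for functions and matrices *)

Section SmoothAt.
Context {R : realType} {n : nat}.
Local Notation E := 'rV[R]_n.
Implicit Types (y v : E) (f h : E -> R^o).

Lemma smooth_at_near_eq f h y : {near y, f =1 h} -> smooth_at y f -> smooth_at y h.
Proof.
rewrite /prop_near1 nbhsE => -[U [oU Uy] fh] [W [oW Wy sf]].
exists (U `&` W); split => //; first exact: openI.
apply: smooth_on_eq (smooth_on_sub (@subIsetr _ _ _) sf); first exact: openI.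
by move=> z [/fh].
Qed.

Lemma smooth_at_near f y : smooth_at y f -> \forall z \near y, smooth_at z f.
Proof.
move=> [U [oU Uy sf]]; have : nbhs y U by exact: open_nbhs_nbhs.
by apply: filterS => z Uz; exists U.
Qed.

Lemma smooth_at_differentiable f y : smooth_at y f -> differentiable f y.
Proof. by move=> [U [oU Uy sf]]; exact: smooth_on_differentiable Uy. Qed.

Lemma smooth_at_derivable f y v : smooth_at y f -> derivable f y v.
Proof. by move=> /smooth_at_differentiable; exact: diff_derivable. Qed.

Lemma smooth_at_derive f y v : smooth_at y f -> smooth_at y ('D_v f).
Proof. by move=> [U [oU Uy sf]]; exists U; split=> //; exact: smooth_on_derive. Qed.

Lemma smooth_at_cst (c : R) y : smooth_at y (cst c).
Proof. by exists setT; split=> //; [exact: openT | exact: smooth_on_cst]. Qed.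

Let smooth_at_algebra2 (op : (E -> R^o) -> (E -> R^o) -> E -> R^o) f h y :
  (forall U, flat_algebra U f -> flat_algebra U h -> flat_algebra U (op f h)) ->
  smooth_at y f -> smooth_at y h -> smooth_at y (op f h).
Proof.
move=> H [U [oU Uy sf]] [W [oW Wy sh]].
have oUW : open (U `&` W) by exact: openI.
exists (U `&` W); split=> //; apply: flat_algebra_smooth_on => //.
by apply: H; apply: flat_algebra_smooth;
  [apply: smooth_on_sub sf; exact: subIsetl | apply: smooth_on_sub sh; exact: subIsetr].
Qed.

Lemma smooth_atD f h y :
  smooth_at y f -> smooth_at y h -> smooth_at y (fun z => f z + h z).
Proof.
apply: (smooth_at_algebra2 (op := fun f h z => f z + h z)) => U.
exact: flat_algebra_add.
Qed.

Lemma smooth_atM f h y :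
  smooth_at y f -> smooth_at y h -> smooth_at y (fun z => f z * h z : R).
Proof.
apply: (smooth_at_algebra2 (op := fun f h z => (f z : R) * h z)) => U.
exact: flat_algebra_mul.
Qed.

Lemma smooth_at_flat k f y : smooth_at y f -> smooth_at y (fun z => flat k (f z)).
Proof.
move=> [U [oU Uy sf]]; exists U; split=> //.
by apply: flat_algebra_smooth_on => //; exact: flat_algebra_flat.
Qed.

Lemma smooth_atN f y : smooth_at y f -> smooth_at y (fun z => - f z).
Proof.
move=> sf; apply: (@smooth_at_near_eq (fun z => -1 * f z : R)).
  by near=> z; rewrite mulN1r.
by apply: smooth_atM => //; exact: smooth_at_cst.
Unshelve. all: by end_near. Qed.

Lemma smooth_atB f h y :
  smooth_at y f -> smooth_at y h -> smooth_at y (fun z => f z - h z).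
Proof. by move=> sf sh; apply: smooth_atD => //; exact: smooth_atN. Qed.

Lemma smooth_at_sum (I : Type) (r : seq I) (P : pred I) (F : I -> E -> R^o) y :
  (forall i, smooth_at y (F i)) ->
  smooth_at y (fun z => \sum_(i <- r | P i) F i z).
Proof.
move=> sF; elim: r => [|i r ih].
  by under eq_fun do rewrite big_nil; exact: smooth_at_cst.
under eq_fun do rewrite big_cons.
by case: (P i) => //; exact: smooth_atD.
Qed.

Lemma derive_coord k y v : 'D_v (fun z : E => z 0 k : R^o) y = v 0 k.
Proof.
have di : derivable (id : E -> E) y v by exact: derivable_id.
have := @derive_mx _ _ 1 n id y v di.
by rewrite derive_id => /matrixP/(_ 0 k); rewrite mxE => <-.
Qed.

Lemma smooth_at_coord y k : smooth_at y (fun z => z 0 k).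
Proof.
exists setT; split=> //; first exact: openT.
move=> vs x _.
have dE v : 'D_v (fun z : E => z 0 k : R^o) = cst (v 0 k).
  by apply/funext => z; exact: derive_coord.
case/lastP: vs => [|vs v] /=; first exact: differentiable_coord.
rewrite foldr_rcons dE; exact: (smooth_on_cst (U := setT)).
Qed.

Lemma smooth_on_smooth_at U f y : open U -> smooth_on U f -> U y -> smooth_at y f.
Proof. by move=> oU sf Uy; exists U. Qed.

Lemma smooth_at_smooth_on U f : (forall y, U y -> smooth_at y f) -> smooth_on U f.
Proof. by move=> sf vs y /sf [W [_ Wy sW]]; exact: sW. Qed.

Lemma smooth_at_swap f y u v : smooth_at y f -> 'D_v ('D_u f) y = 'D_u ('D_v f) y.
Proof.
move=> sf; apply: derive_swap.
- by apply: filterS (smooth_at_near sf) => z; exact: smooth_at_differentiable.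
- exact/smooth_at_differentiable/smooth_at_derive.
- exact/smooth_at_differentiable/smooth_at_derive.
Qed.

Lemma smooth_at_deriveM (f h : E -> R) y v : smooth_at y f -> smooth_at y h ->
  'D_v (fun z => f z * h z : R^o) y
  = f y * 'D_v (h : E -> R^o) y + h y * 'D_v (f : E -> R^o) y :> R.
Proof.
move=> sf sh; have df : derivable (f : E -> R^o) y v by exact: smooth_at_derivable.
have dh : derivable (h : E -> R^o) y v by exact: smooth_at_derivable.
exact: deriveM df dh.
Qed.

Lemma smooth_at_deriveB (f h : E -> R) y v : smooth_at y f -> smooth_at y h ->
  'D_v (fun z => f z - h z : R^o) y
  = 'D_v (f : E -> R^o) y - 'D_v (h : E -> R^o) y :> R.
Proof.
move=> sf sh; have df : derivable (f : E -> R^o) y v by exact: smooth_at_derivable.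
have dh : derivable (h : E -> R^o) y v by exact: smooth_at_derivable.
exact: deriveB df dh.
Qed.

Lemma smooth_at_deriveN (f : E -> R) y v : smooth_at y f ->
  'D_v (fun z => - f z : R^o) y = - 'D_v (f : E -> R^o) y :> R.
Proof.
move=> sf; have df : derivable (f : E -> R^o) y v by exact: smooth_at_derivable.
exact: deriveN df.
Qed.

Lemma smooth_at_derive_sum m (F : 'I_m -> E -> R) y v : (forall k, smooth_at y (F k)) ->
  'D_v (fun z => \sum_k F k z : R^o) y = \sum_k 'D_v (F k : E -> R^o) y.
Proof.
move=> sF; rewrite -(derive_sum (h := fun k => (F k : E -> R^o))); last first.
  by move=> k; exact: smooth_at_derivable.
by congr ('D_v _ y); apply/funext => z; rewrite fct_sumE.
Qed.

Lemma derive_coordE (V : normedModType R) (f : E -> V) y v : differentiable f y ->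
  'D_v f y = \sum_k v 0 k *: 'D_(delta_mx 0 k) f y.
Proof.
move=> df; rewrite deriveE // {1}[v]row_sum_delta linear_sum.
by apply: eq_bigr => k _; rewrite linearZ deriveE.
Qed.

Definition smooth_mx_at (m p : nat) y (F : E -> 'M[R]_(m, p)) :=
  forall i j, smooth_at y (fun z => F z i j).

Lemma smooth_mx_at_derivable m p (F : E -> 'M[R]_(m, p)) y v :
  smooth_mx_at y F -> derivable F y v.
Proof. by move=> sF; apply/derivable_mxP => i j; exact: smooth_at_derivable. Qed.

Lemma smooth_mx_at_entry m p (F : E -> 'M[R]_(m, p)) y v i j :
  smooth_mx_at y F -> ('D_v F y) i j = 'D_v (fun z => F z i j) y.
Proof. by move=> sF; rewrite derive_mx ?mxE//; exact: smooth_mx_at_derivable. Qed.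

Lemma smooth_mx_at_near m p (F : E -> 'M[R]_(m, p)) y :
  smooth_mx_at y F -> \forall z \near y, smooth_mx_at z F.
Proof.
move=> sF.
apply: (@filter_forall _ _ (fun i z => forall j, smooth_at z (fun x => F x i j)) (nbhs y)) => i.
apply: (@filter_forall _ _ (fun j z => smooth_at z (fun x => F x i j)) (nbhs y)) => j.
exact: smooth_at_near.
Qed.

Lemma smooth_mx_at_derive m p (F : E -> 'M[R]_(m, p)) y v :
  smooth_mx_at y F -> smooth_mx_at y ('D_v F).
Proof.
move=> sF i j; apply: smooth_at_near_eq (smooth_at_derive v (sF i j)).
by apply: filterS (smooth_mx_at_near sF) => z sFz; rewrite smooth_mx_at_entry.
Qed.

(** Iterated derivatives commute with taking an entry, so the smoothness of a matrix-valued map,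
    stated for the normed space of matrices, passes to its entries. *)
Lemma smooth_on_mx_at m p (F : E -> 'M[R]_(m, p)) U y :
  open U -> smooth_on U F -> U y -> smooth_mx_at y F.
Proof.
move=> oU sF Uy i j; apply: (@smooth_on_smooth_at U) => //.
have dE vs z : U z -> (foldr (fun v k => 'D_v k) F vs z) i j =
    foldr (fun v k => 'D_v k) (fun x => F x i j : R^o) vs z.
  elim: vs z => //= v vs ih z Uz.
  rewrite derive_mx ?mxE; last exact/diff_derivable/sF.
  apply: near_eq_derive; apply: filterS ih _; exact: open_nbhs_nbhs.
move=> vs z Uz.
apply: (@near_eq_differentiable _ _ _
    (fun x => (foldr (fun v k => 'D_v k) F vs x) i j : R^o)).
  by apply: filterS (dE vs) _; exact: open_nbhs_nbhs.
apply: (@differentiable_comp _ _ _ _ (foldr (fun v k => 'D_v k) F vs)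
  (fun N : 'M[R]_(m, p) => N i j : R^o)); first exact: sF.
exact: differentiable_coord.
Qed.

Lemma smooth_mx_atM m p q (F : E -> 'M[R]_(m, p)) (G : E -> 'M[R]_(p, q)) y :
  smooth_mx_at y F -> smooth_mx_at y G -> smooth_mx_at y (fun z => F z *m G z).
Proof.
move=> sF sG i j; under eq_fun do rewrite mxE.
by apply: smooth_at_sum => k; exact: smooth_atM.
Qed.

Lemma smooth_mx_at_tr m p (F : E -> 'M[R]_(m, p)) y :
  smooth_mx_at y F -> smooth_mx_at y (fun z => (F z)^T).
Proof. by move=> sF i j; under eq_fun do rewrite mxE. Qed.

Lemma smooth_mx_atD m p (F G : E -> 'M[R]_(m, p)) y :
  smooth_mx_at y F -> smooth_mx_at y G -> smooth_mx_at y (fun z => F z + G z).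
Proof. by move=> sF sG i j; under eq_fun do rewrite mxE; exact: smooth_atD. Qed.

Lemma smooth_mx_atB m p (F G : E -> 'M[R]_(m, p)) y :
  smooth_mx_at y F -> smooth_mx_at y G -> smooth_mx_at y (fun z => F z - G z).
Proof. by move=> sF sG i j; under eq_fun do rewrite !mxE; exact: smooth_atB. Qed.

Lemma smooth_mx_atZ m p (f : E -> R^o) (F : E -> 'M[R]_(m, p)) y :
  smooth_at y f -> smooth_mx_at y F -> smooth_mx_at y (fun z => (f z : R) *: F z).
Proof. by move=> sf sF i j; under eq_fun do rewrite mxE; exact: smooth_atM. Qed.

(** The direction now varies with the point; expanding it in the standard basis reduces to
    derivatives in constant directions with smooth coefficients. *)
Lemma smooth_at_derive_along f (X : E -> E) y :
  smooth_at y f -> smooth_mx_at y X -> smooth_at y (fun z => 'D_(X z) f z).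
Proof.
move=> sf sX; apply: (@smooth_at_near_eq
    (fun z => \sum_k (X z 0 k * 'D_(delta_mx 0 k) f z))).
  apply: filterS (smooth_at_near sf) => z /smooth_at_differentiable df.
  by rewrite [RHS]derive_coordE.
by apply: smooth_at_sum => k; apply: smooth_atM => //; exact: smooth_at_derive.
Qed.

Lemma smooth_mx_at_derive_along m p (F : E -> 'M[R]_(m, p)) (X : E -> E) y :
  smooth_mx_at y F -> smooth_mx_at y X -> smooth_mx_at y (fun z => 'D_(X z) F z).
Proof.
move=> sF sX i j; apply: smooth_at_near_eq (smooth_at_derive_along (sF i j) sX).
by apply: filterS (smooth_mx_at_near sF) => z sFz; rewrite smooth_mx_at_entry.
Qed.

Lemma is_derive_mulmx m p q (F : E -> 'M[R]_(m, p)) (G : E -> 'M[R]_(p, q)) y v :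
  derivable F y v -> derivable G y v ->
  is_derive y v (fun z => F z *m G z) ('D_v F y *m G y + F y *m 'D_v G y).
Proof.
move=> dF dG.
have dFE i k : derivable (fun z => F z i k) y v by have /derivable_mxP := dF; apply.
have dGE k j : derivable (fun z => G z k j) y v by have /derivable_mxP := dG; apply.
have E i j : (fun z => (F z *m G z) i j)
    = \sum_k ((fun z => F z i k) * (fun z => G z k j)).
  by apply/funext => z; rewrite mxE fct_sumE.
have dFG : derivable (fun z => F z *m G z) y v.
  by apply/derivable_mxP => i j; rewrite E; apply: derivable_sum => k; exact: derivableM.
apply: (DeriveDef dFG); apply/matrixP => i j; rewrite derive_mx // mxE.
rewrite !mxE -big_split /= E derive_sum; last by move=> k; exact: derivableM.
apply: eq_bigr => k _; rewrite deriveM // (derive_mx dF) (derive_mx dG) !mxE.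
by rewrite [LHS]addrC; congr (_ + _); rewrite [LHS]mulrC.
Qed.

Lemma derive_trmx m p (F : E -> 'M[R]_(m, p)) y v :
  derivable F y v -> is_derive y v (fun z => (F z)^T) ('D_v F y)^T.
Proof.
move=> dF; have dT : derivable (fun z => (F z)^T) y v.
  apply/derivable_mxP => i j; under eq_fun do rewrite mxE.
  by have /derivable_mxP := dF; apply.
apply: (DeriveDef dT); apply/matrixP => i j; rewrite derive_mx // (derive_mx dF) !mxE.
by under eq_fun do rewrite mxE.
Qed.

End SmoothAt.

(** * Complex-valued functions *)

Section ComplexCalculus.
Context {R : realType} {n : nat}.
Local Notation E := 'rV[R]_n.
Implicit Types (y v : E) (f h : E -> R[i]).

Definition csmooth_at y f :=
  smooth_at y (fun z => complex.Re (f z)) /\ smooth_at y (fun z => complex.Im (f z)).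

Definition cderive v f y : R[i] :=
  'D_v (fun z => complex.Re (f z) : R^o) y +i* 'D_v (fun z => complex.Im (f z) : R^o) y.

Lemma ReM (a b : R[i]) :
  complex.Re (a * b) = complex.Re a * complex.Re b - complex.Im a * complex.Im b.
Proof. by case: a b => [? ?] [? ?]. Qed.

Lemma ImM (a b : R[i]) :
  complex.Im (a * b) = complex.Re a * complex.Im b + complex.Im a * complex.Re b.
Proof. by case: a b => [? ?] [? ?]. Qed.

Lemma ReD (a b : R[i]) : complex.Re (a + b) = complex.Re a + complex.Re b.
Proof. by case: a b => [? ?] [? ?]. Qed.

Lemma ImD (a b : R[i]) : complex.Im (a + b) = complex.Im a + complex.Im b.
Proof. by case: a b => [? ?] [? ?]. Qed.

Lemma csmooth_at_near_eq f h y : {near y, f =1 h} -> csmooth_at y f -> csmooth_at y h.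
Proof.
by move=> fh [s1 s2]; split; [apply: smooth_at_near_eq s1 | apply: smooth_at_near_eq s2];
  apply: filterS fh => z ->.
Qed.

Lemma cderive_near_eq f h y v : {near y, f =1 h} -> cderive v f y = cderive v h y.
Proof.
by move=> fh; rewrite /cderive; congr (_ +i* _); apply: near_eq_derive;
  apply: filterS fh => z ->.
Qed.

Lemma csmooth_at_cst (c : R[i]) y : csmooth_at y (cst c).
Proof. by split; exact: smooth_at_cst. Qed.

Lemma csmooth_at_real (f : E -> R^o) y : smooth_at y f -> csmooth_at y (fun z => (f z)%:C).
Proof. by move=> sf; split => //; exact: smooth_at_cst. Qed.

Lemma csmooth_atD f h y :
  csmooth_at y f -> csmooth_at y h -> csmooth_at y (fun z => f z + h z).
Proof.
move=> [s1 s2] [t1 t2]; split.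
  by under eq_fun do rewrite ReD; exact: smooth_atD.
by under eq_fun do rewrite ImD; exact: smooth_atD.
Qed.

Lemma csmooth_atM f h y :
  csmooth_at y f -> csmooth_at y h -> csmooth_at y (fun z => f z * h z).
Proof.
move=> [s1 s2] [t1 t2]; split.
  by under eq_fun do rewrite ReM; apply: smooth_atB; exact: smooth_atM.
by under eq_fun do rewrite ImM; apply: smooth_atD; exact: smooth_atM.
Qed.

Lemma csmooth_at_sum (I : Type) (r : seq I) (P : pred I) (F : I -> E -> R[i]) y :
  (forall i, csmooth_at y (F i)) ->
  csmooth_at y (fun z => \sum_(i <- r | P i) F i z).
Proof.
move=> sF; elim: r => [|i r ih].
  by under eq_fun do rewrite big_nil; exact: csmooth_at_cst.
under eq_fun do rewrite big_cons.
by case: (P i) => //; exact: csmooth_atD.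
Qed.

Lemma csmooth_at_cderive_along f (X : E -> E) y :
  csmooth_at y f -> smooth_mx_at y X -> csmooth_at y (fun z => cderive (X z) f z).
Proof. by move=> [s1 s2] sX; split; exact: smooth_at_derive_along. Qed.

Lemma cderive_cst (c : R[i]) y v : cderive v (cst c) y = 0.
Proof. by rewrite /cderive !derive_cst. Qed.

Lemma cderiveD f h y v : csmooth_at y f -> csmooth_at y h ->
  cderive v (fun z => f z + h z) y = cderive v f y + cderive v h y.
Proof.
move=> [s1 s2] [t1 t2]; rewrite /cderive.
under eq_fun do rewrite ReD.
under [X in _ +i* 'D_v X y]eq_fun do rewrite ImD.
by rewrite !deriveD //; exact: smooth_at_derivable.
Qed.

Lemma cderiveM f h y v : csmooth_at y f -> csmooth_at y h ->
  cderive v (fun z => f z * h z) y = cderive v f y * h y + f y * cderive v h y.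
Proof.
move=> [s1 s2] [t1 t2]; rewrite /cderive.
under eq_fun do rewrite ReM.
under [X in _ +i* 'D_v X y]eq_fun do rewrite ImM.
have dM (k l : E -> R^o) : smooth_at y k -> smooth_at y l ->
    'D_v (fun z => k z * l z : R^o) y = (k y * 'D_v l y + l y * 'D_v k y : R).
  by move=> sk sl; rewrite -[LHS]/('D_v ((k : E -> R) * l) y) deriveM //;
    exact: smooth_at_derivable.
rewrite deriveB ?deriveD ?dM //; last first.
  by apply/smooth_at_derivable/smooth_atM.
  by apply/smooth_at_derivable/smooth_atM.
  by apply/smooth_at_derivable/smooth_atM.
  by apply/smooth_at_derivable/smooth_atM.
case: (f y) (h y) => [a b] [a' b'] /=.
move: ('D_v _ y) ('D_v _ y) ('D_v _ y) ('D_v _ y) => d1 d2 d3 d4.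
by apply/eqP; rewrite eq_complex /=; apply/andP; split; apply/eqP;
  rewrite /GRing.scale /=; ring.
Qed.

Lemma cderive_sum (I : Type) (r : seq I) (F : I -> E -> R[i]) y v :
  (forall i, csmooth_at y (F i)) ->
  cderive v (fun z => \sum_(i <- r) F i z) y = \sum_(i <- r) cderive v (F i) y.
Proof.
move=> sF; elim: r => [|i r ih].
  by under eq_fun do rewrite big_nil; rewrite big_nil cderive_cst.
under eq_fun do rewrite big_cons.
by rewrite big_cons cderiveD ?ih //; exact: csmooth_at_sum.
Qed.

Lemma cderiveZ (c : R[i]) h y v : csmooth_at y h ->
  cderive v (fun z => c * h z) y = c * cderive v h y.
Proof.
by move=> sh; rewrite (cderiveM v (csmooth_at_cst c y) sh) cderive_cst mul0r add0r.
Qed.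

Lemma cderive_real (f : E -> R^o) y v : cderive v (fun z => (f z)%:C) y = ('D_v f y)%:C.
Proof. by rewrite /cderive /= derive_cst. Qed.

End ComplexCalculus.

(** * Charts *)

Section Charts.
Context {R : realType} {n : nat} {M : manifold R n}.
Implicit Types (i j : chart M) (x : M) (W : set M).

Lemma near_param i x (P : set M) : dom M i x -> (\forall y \near x, P y) ->
  \forall z \near coord M i x, P (param M i z).
Proof.
move=> ix nP; have cp : {for coord M i x, continuous (param M i)}.
  by apply: param_continuous; exists x.
by apply: cp; rewrite coordK.
Qed.

Lemma near_dom i x : dom M i x -> \forall y \near x, dom M i y.
Proof. by move=> ix; apply: open_nbhs_nbhs; split=> //; exact: dom_open. Qed.

Lemma near_coordK i x : dom M i x ->
  \forall z \near coord M i x, coord M i (param M i z) = z.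
Proof.
move=> ix; have : nbhs (coord M i x) (coord M i @` dom M i).
  by apply: open_nbhs_nbhs; split; [exact: range_open | exists x].
by apply: filterS => _ [y iy <-]; rewrite coordK.
Qed.

Lemma chart_image_open i W : open W -> open (coord M i @` (dom M i `&` W)).
Proof.
move=> oW; rewrite openE => _ [x [ix Wx] <-]; rewrite /interior.
have h1 : \forall z \near coord M i x, dom M i (param M i z) /\ W (param M i z).
  apply: (near_param ix (P := fun y => dom M i y /\ W y)).
  by apply: filterI; [exact: near_dom | exact: open_nbhs_nbhs].
apply: filterS2 h1 (near_coordK ix) => z [iz Wz] zK.
by exists (param M i z).
Qed.

Lemma smooth_in_at i W m p (F : M -> 'M[R]_(m, p)) x : open W ->
  smooth_in i W F -> W x -> dom M i x -> smooth_mx_at (coord M i x) (F \o param M i).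
Proof.
move=> oW sF Wx ix; apply: (@smooth_on_mx_at _ _ _ _ _ (coord M i @` (dom M i `&` W))) => //.
  exact: chart_image_open.
by exists x.
Qed.

Lemma smooth_fun_at i W (f : M -> R) x : open W ->
  smooth_fun W f -> W x -> dom M i x ->
  smooth_at (coord M i x) (fun z => f (param M i z)).
Proof.
move=> oW sf Wx ix.
apply: (@smooth_on_smooth_at _ _ (coord M i @` (dom M i `&` W))) => //.
- exact: chart_image_open.
- exact: sf.
- by exists x.
Qed.

Lemma smooth_cfun_at i W (f : M -> R[i]) x : open W ->
  smooth_cfun W f -> W x -> dom M i x ->
  csmooth_at (coord M i x) (fun z => f (param M i z)).
Proof. by move=> oW [s1 s2] Wx ix; split;
  [exact: (smooth_fun_at oW s1 Wx ix) | exact: (smooth_fun_at oW s2 Wx ix)]. Qed.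

Lemma at_smooth_fun W (f : M -> R) :
  (forall i x, W x -> dom M i x -> smooth_at (coord M i x) (fun z => f (param M i z))) ->
  smooth_fun W f.
Proof. by move=> sf i; apply: smooth_at_smooth_on => _ [x [ix Wx] <-]; exact: sf. Qed.

Lemma at_smooth_cfun W (f : M -> R[i]) :
  (forall i x, W x -> dom M i x -> csmooth_at (coord M i x) (fun z => f (param M i z))) ->
  smooth_cfun W f.
Proof. by move=> sf; split; apply: at_smooth_fun => i x Wx ix; have [] := sf i x Wx ix. Qed.

Lemma transition_smooth_at i j x : dom M i x -> dom M j x ->
  smooth_mx_at (coord M i x) (coord M j \o param M i).
Proof.
move=> ix jx; apply: (smooth_on_mx_at (chart_image_open (dom_open j))).
  exact: transition_smooth.
by exists x.
Qed.

End Charts.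

(** * The Dirac operator *)

Section FrameMatrix.
Context {R : realType} {M : manifold R 2} {g : metric M} (S : spin_structure g).
Implicit Types (i : chart M) (a b : gauge S) (x : M).

Definition frame_mx a i x : 'M[R]_2 := \matrix_(k < 2) frame a k i x.

Lemma row_frame_mx a i x k : row k (frame_mx a i x) = frame a k i x.
Proof. by rewrite rowK. Qed.

Lemma frame_gram a i x : gdom a x -> dom M i x ->
  frame_mx a i x *m g i x *m (frame_mx a i x)^T = 1%:M.
Proof.
move=> ax ix; apply/matrixP => k l; rewrite [RHS]mxE.
rewrite -(frame_orthonormal k l ax ix) /bil -!row_frame_mx !mxE.
apply: eq_bigr => m _; rewrite !mxE; congr (_ * _).
by apply: eq_bigr => m' _; rewrite !mxE.
Qed.

(** Makes the inverse metric polynomial in the frame, so its smoothness follows from that of the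
    frame without differentiating a matrix inverse. *)
Lemma frame_gram_inv a i x : gdom a x -> dom M i x ->
  invmx (g i x) = (frame_mx a i x)^T *m frame_mx a i x.
Proof.
move=> ax ix; have := frame_gram ax ix; rewrite -mulmxA => /mulmx1C gPP.
have gu : g i x \in unitmx := gram_unit g ix.
by rewrite -[RHS](mulKmx gu) [g i x *m (_ *m _)]mulmxA gPP mulmx1.
Qed.

Lemma frame_mx_unit a i x : gdom a x -> dom M i x -> frame_mx a i x \in unitmx.
Proof.
by move=> ax ix; rewrite unitmxE unitfE gt_eqF // (frame_oriented ax ix).
Qed.

Lemma frame_smooth_at a k i x : gdom a x -> dom M i x ->
  smooth_mx_at (coord M i x) (fun z => frame a k i (param M i z)).
Proof.
move=> ax ix; have [sf _] := frame_field (s := S) a k.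
by apply: (smooth_in_at (W := gdom a)) => //; exact: gdom_open.
Qed.

Lemma frame_mx_smooth_at a i x : gdom a x -> dom M i x ->
  smooth_mx_at (coord M i x) (fun z => frame_mx a i (param M i z)).
Proof.
by move=> ax ix k l; under eq_fun do rewrite mxE; exact: frame_smooth_at.
Qed.

End FrameMatrix.

Lemma gram_smooth_at (R : realType) (n : nat) (M : manifold R n) (g : metric M)
    (i : chart M) (x : M) : dom M i x ->
  smooth_mx_at (coord M i x) (fun z => g i (param M i z)).
Proof.
by move=> ix; apply: (smooth_in_at (W := setT)) => //; [exact: openT | exact: gram_smooth].
Qed.

Section Dirac.
Context {R : realType} {M : manifold R 2} {g : metric M} (S : spin_structure g).
Implicit Types (i : chart M) (a b : gauge S) (x : M) (psi : spinors S).

(** Half the Levi-Civita connection form of the frame, evaluated on its k-th vector: the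
    zeroth-order part of the spin connection. *)
Definition spin_coef i a k x : R :=
  2^-1 * bil (g i x) (nabla g i (frame a k i x) (frame a 0 i) x) (frame a 1 i x).

Lemma diracE i psi a x : dirac i psi a x = \sum_(k < 2) cliff R k *m
  ((\col_r cdiff i (fun y => psi a y r 0) (frame a k i x) x)
   + (spin_coef i a k x)%:C *: (vol_mx R *m psi a x)).
Proof. by []. Qed.

Lemma spin_coef_smooth i a k x : gdom a x -> dom M i x ->
  smooth_at (coord M i x) (fun z => spin_coef i a k (param M i z)).
Proof.
move=> ax ix; set y := coord M i x.
pose G z := g i (param M i z).
pose X z := frame a k i (param M i z).
pose Y z := frame a 0 i (param M i z).
pose Z z := frame a 1 i (param M i z).
pose P z := frame_mx a i (param M i z).
pose B z := \row_l bil ('D_(delta_mx 0 l) G z) (X z) (Y z).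
(* The covariant derivative of [Y] along [X], with the inverse Gram matrix replaced by its
   expression in the frame. *)
pose Nb z := 'D_(X z) Y z + (cst 2^-1 z : R) *: ((Y z *m 'D_(X z) G z + X z *m 'D_(Y z) G z
   - B z) *m ((P z)^T *m P z)).
have sG : smooth_mx_at y G by exact: gram_smooth_at.
have sX : smooth_mx_at y X by exact: frame_smooth_at.
have sY : smooth_mx_at y Y by exact: frame_smooth_at.
have sZ : smooth_mx_at y Z by exact: frame_smooth_at.
have sP : smooth_mx_at y P by exact: frame_mx_smooth_at.
have sB : smooth_mx_at y B.
  move=> r l; under eq_fun do rewrite mxE /bil.
  apply: smooth_mx_atM; last exact: smooth_mx_at_tr.
  by apply: smooth_mx_atM => //; exact: smooth_mx_at_derive.
have sN : smooth_mx_at y Nb.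
  apply: smooth_mx_atD; first exact: smooth_mx_at_derive_along.
  apply: smooth_mx_atZ; first exact: smooth_at_cst.
  apply: smooth_mx_atM; last by apply: smooth_mx_atM => //; exact: smooth_mx_at_tr.
  apply: smooth_mx_atB => //.
  by apply: smooth_mx_atD; apply: smooth_mx_atM => //; exact: smooth_mx_at_derive_along.
apply: (@smooth_at_near_eq _ _ (fun z => 2^-1 * (Nb z *m G z *m (Z z)^T) 0 0 : R)).
  have oa : \forall y \near x, gdom a y /\ dom M i y.
    by apply: filterI; [apply: open_nbhs_nbhs; split => //; exact: gdom_open | exact: near_dom].
  apply: filterS2 (near_coordK ix) (near_param ix oa) => z zK [az iz].
  rewrite /spin_coef /bil /nabla /christoffel /pdiff zK.
  by rewrite (frame_gram_inv az iz).
apply: smooth_atM; first exact: smooth_at_cst.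
apply: smooth_mx_atM; last exact: smooth_mx_at_tr.
exact: smooth_mx_atM.
Qed.

Definition spinor_smooth_at i psi a x :=
  forall r, csmooth_at (coord M i x) (fun z => psi a (param M i z) r 0).

Lemma dirac_smooth_at i psi a x : gdom a x -> dom M i x ->
  spinor_smooth_at i psi a x -> spinor_smooth_at i (dirac i psi) a x.
Proof.
move=> ax ix sp r; set y := coord M i x.
pose X k z := frame a k i (param M i z).
pose u z := psi a (param M i z).
apply: (@csmooth_at_near_eq _ _ (fun z => \sum_(k < 2) \sum_j cliff R k r j *
    (cderive (X k z) (fun z => u z j 0) z +
     (spin_coef i a k (param M i z))%:C * \sum_l vol_mx R j l * u z l 0))).
  apply: filterS (near_coordK ix) => z zK.
  rewrite diracE summxE; apply: eq_bigr => k _; rewrite mxE; apply: eq_bigr => j _.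
  by rewrite !mxE /cdiff /pdiff zK.
apply: csmooth_at_sum => k; apply: csmooth_at_sum => j.
apply: csmooth_atM; first exact: csmooth_at_cst.
apply: csmooth_atD.
  by apply: csmooth_at_cderive_along; [exact: sp | exact: frame_smooth_at].
apply: csmooth_atM; first by apply: csmooth_at_real; exact: spin_coef_smooth.
apply: csmooth_at_sum => l; apply: csmooth_atM; first exact: csmooth_at_cst.
exact: sp.
Qed.

Lemma diracD i (psi psi' : spinors S) a x :
  spinor_smooth_at i psi a x -> spinor_smooth_at i psi' a x ->
  dirac i (fun a x => psi a x + psi' a x) a x = dirac i psi a x + dirac i psi' a x.
Proof.
move=> s1 s2; rewrite !diracE -big_split /=; apply: eq_bigr => k _.
rewrite -mulmxDr; congr (_ *m _); rewrite mulmxDr scalerDr addrACA; congr (_ + _).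
apply/matrixP => r j; rewrite !mxE.
rewrite -[LHS]/(cderive _ (fun z => (psi a (param M i z) + psi' a (param M i z)) r 0) _).
under eq_fun do rewrite mxE.
by rewrite cderiveD //.
Qed.

Lemma diracZ i (p : M -> R[i]) psi a x :
  csmooth_at (coord M i x) (fun z => p (param M i z)) -> dom M i x ->
  spinor_smooth_at i psi a x ->
  dirac i (fun a x => p x *: psi a x) a x = p x *: dirac i psi a x
    + \sum_(k < 2) cdiff i p (frame a k i x) x *: (cliff R k *m psi a x).
Proof.
move=> sp ix s1; rewrite !diracE scaler_sumr -big_split /=; apply: eq_bigr => k _.
rewrite !scalemxAr -mulmxDr; congr (_ *m _).
rewrite scalerDr addrAC; congr (_ + _); last by rewrite -!scalemxAr !scalerA mulrC.
apply/matrixP => r j; rewrite !mxE (ord1 j).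
rewrite -[LHS]/(cderive _ (fun z => (p (param M i z) *: psi a (param M i z)) r 0) _).
under eq_fun do rewrite mxE.
by rewrite cderiveM // addrC /= coordK.
Qed.

Lemma cliff_vol k : cliff R k *m vol_mx R = - (vol_mx R *m cliff R k).
Proof.
apply/matrixP => r s; rewrite /vol_mx !mxE !big_ord_recl !big_ord0 !mxE !big_ord_recl !big_ord0.
rewrite /cliff; case: k => [[|[|//]] ?]; case: r => [[|[|//]] ?]; case: s => [[|[|//]] ?];
  by rewrite !mxE /=; simpc.
Qed.

Lemma vol_mx2 : vol_mx R *m vol_mx R = - 1%:M.
Proof.
apply/matrixP => r s; rewrite /vol_mx !mxE !big_ord_recl !big_ord0 !mxE !big_ord_recl !big_ord0.
rewrite /cliff; case: r => [[|[|//]] ?]; case: s => [[|[|//]] ?];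
  by rewrite !mxE /=; simpc.
Qed.

(** In every gauge omega is a constant matrix that commutes with the connection term, hence is
    parallel; the sign comes from its anticommuting with each frame vector. *)
Lemma dirac_omega i psi a x : spinor_smooth_at i psi a x ->
  dirac i (omega psi) a x = - omega (dirac i psi) a x.
Proof.
move=> s1; rewrite /omega !diracE mulmx_sumr -sumrN; apply: eq_bigr => k _.
rewrite [X in _ = - X]mulmxA -mulNmx -cliff_vol -[RHS]mulmxA; congr (_ *m _).
rewrite mulmxDr -scalemxAr; congr (_ + _).
apply/matrixP => r j; rewrite !mxE.
rewrite -[LHS]/(cderive _ (fun z => (vol_mx R *m psi a (param M i z)) r 0) _).
under eq_fun do rewrite mxE.
rewrite cderive_sum; last by move=> l; apply: csmooth_atM => //; exact: csmooth_at_cst.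
by apply: eq_bigr => l _; rewrite cderiveZ //; congr (_ * _); rewrite mxE.
Qed.

Lemma omega_smooth_at i psi a x :
  spinor_smooth_at i psi a x -> spinor_smooth_at i (omega psi) a x.
Proof.
move=> s1 r; under eq_fun do rewrite mxE.
by apply: csmooth_at_sum => l; apply: csmooth_atM => //; exact: csmooth_at_cst.
Qed.

Lemma spinorZ_smooth_at i (p : M -> R[i]) psi a x :
  csmooth_at (coord M i x) (fun z => p (param M i z)) ->
  spinor_smooth_at i psi a x -> spinor_smooth_at i (fun a x => p x *: psi a x) a x.
Proof. by move=> sp s1 r; under eq_fun do rewrite mxE; exact: csmooth_atM. Qed.

Lemma spinorD_smooth_at i psi psi' a x :
  spinor_smooth_at i psi a x -> spinor_smooth_at i psi' a x ->
  spinor_smooth_at i (fun a x => psi a x + psi' a x) a x.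
Proof. by move=> s1 s2 r; under eq_fun do rewrite mxE; exact: csmooth_atD. Qed.

(* The D^2 psi terms of the two sides cancel, so the factorization is a first-order
   identity, with coefficient p + f + (h - q - 2 eta) omega in front of D psi. *)
Lemma factorization_first_order W c eta H nA f h p q psi i a x :
  open W -> monic_factorization S W c eta H nA f h p q -> spinor_section W psi ->
  W x -> dom M i x -> gdom a x ->
  (p x + f x) *: dirac i psi a x
  + (h x - q x - 2 * eta) *: (vol_mx R *m dirac i psi a x)
  + (\sum_(k < 2) (cdiff i p (frame a k i x) x *: cliff R k
        + cdiff i q (frame a k i x) x *: (cliff R k *m vol_mx R))
     + (f x * p x - h x * q x - (nA x - H x ^+ 2 - 2 * c)%:C)%:M
     + (h x * p x + f x * q x + 2 * eta * (H x)%:C) *: vol_mx R) *m psi a x = 0.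
Proof.
move=> oW [[_ _ sp sq] fact] spsi Wx ix ax.
have s0 : spinor_smooth_at i psi a x.
  move=> r; have oWa : open (W `&` gdom a) by apply: openI => //; exact: gdom_open.
  by case: spsi => /(_ a r) spsi _; exact: (smooth_cfun_at oWa spsi (conj Wx ax) ix).
have sp' := smooth_cfun_at oW sp Wx ix.
have sq' := smooth_cfun_at oW sq Wx ix.
have so := omega_smooth_at s0.
have sd := dirac_smooth_at ax ix s0.
have := fact _ spsi i a x Wx ix ax; rewrite /Bop /scalar_chiral.
set Dpsi := dirac i psi.
have sps : spinor_smooth_at i (fun a x => p x *: psi a x) a x.
  exact: (@spinorZ_smooth_at i p psi a x sp' s0).
have sqs : spinor_smooth_at i (fun a x => q x *: omega psi a x) a x.
  exact: (@spinorZ_smooth_at i q (omega psi) a x sq' so).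
have sZd : spinor_smooth_at i (fun a x => Dpsi a x + p x *: psi a x) a x.
  exact: (@spinorD_smooth_at i Dpsi (fun a x => p x *: psi a x) a x sd sps).
rewrite (diracD sZd sqs) (diracD sd sps).
rewrite (diracZ sp' ix s0) (diracZ sq' ix so) (dirac_omega s0).
rewrite /omega -/Dpsi.
rewrite mulmxDl mulmxDl mulmx_suml mul_scalar_mx -scalemxAl.
under [X in _ -> _ + (X + _ + _) = 0]eq_bigr do rewrite mulmxDl -!scalemxAl -mulmxA.
rewrite big_split /=.
set S1 := \sum_(_ < _) _; set S2 := \sum_(_ < _) _.
rewrite !mulmxDr -!scalemxAr !(mulmxA (vol_mx R) (vol_mx R)) vol_mx2 mulNmx mul1mx.
move: (dirac i Dpsi a x) => DD; move: (Dpsi a x) S1 S2 => D1 S1 S2.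
move: (vol_mx R *m psi a x) (vol_mx R *m D1) (psi a x) => w wD u.
move=> E; apply/matrixP => r s; move/matrixP : E => /(_ r s); rewrite !mxE.
move: (\sum_j _) (DD r s) (D1 r s) (wD r s) (S1 r s) (S2 r s) (u r s).
move: (_%:C) ((H x)%:C) => K Hx vu d2 d1 wd s1 s2 u0 /eqP.
by rewrite -subr_eq0 => /eqP E; rewrite -[RHS]oppr0 -E; ring.
Qed.

End Dirac.

(** * Test spinors *)

Section Bump.
Context {R : realType} {n : nat}.
Local Notation E := 'rV[R]_n.

(* The affine factor prescribes the value (w = 0) or the first derivative (d = 0) at y0. *)
Definition bump (y0 : E) (r d : R) (w : E) (z : E) : R :=
  flat 0 (r ^+ 2 - \sum_k (z 0 k - y0 0 k) ^+ 2) * (d + \sum_k (z 0 k - y0 0 k) * w 0 k).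

(** The composition with [T] is needed because a test spinor is centred in one chart but must be
    smooth when read in any other, through a transition map. *)
Lemma bump_comp_smooth y0 r d w m (T : 'rV[R]_m -> E) z :
  smooth_mx_at z T -> smooth_at z (fun u => bump y0 r d w (T u)).
Proof.
move=> sT; have sc k : smooth_at z (fun u => T u 0 k - y0 0 k).
  by apply: smooth_atB; [exact: sT | exact: smooth_at_cst].
apply: smooth_atM.
  apply: smooth_at_flat; apply: smooth_atB; first exact: smooth_at_cst.
  by apply: smooth_at_sum => k; exact: smooth_atM.
apply: smooth_atD; first exact: smooth_at_cst.
by apply: smooth_at_sum => k; apply: smooth_atM => //; exact: smooth_at_cst.
Qed.

Lemma bump_smooth y0 r d w z : smooth_at z (bump y0 r d w).
Proof. by apply: bump_comp_smooth => i j; rewrite (ord1 i); exact: smooth_at_coord. Qed.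

Lemma bump_center y0 r d w : bump y0 r d w y0 = flat 0 (r ^+ 2) * d.
Proof.
rewrite /bump !big1 ?subr0 ?addr0 // => k _; first by rewrite subrr mul0r.
by rewrite subrr expr0n.
Qed.

Lemma derive_bump_center y0 r w v :
  'D_v (bump y0 r 0 w : E -> R^o) y0 = flat 0 (r ^+ 2) * \sum_k v 0 k * w 0 k.
Proof.
pose F (z : E) : R := flat 0 (r ^+ 2 - \sum_k (z 0 k - y0 0 k) ^+ 2).
pose L (z : E) : R := \sum_k (z 0 k - y0 0 k) * w 0 k.
have sc k : smooth_at y0 (fun u => u 0 k - y0 0 k).
  by apply: smooth_atB; [exact: smooth_at_coord | exact: smooth_at_cst].
have sF : smooth_at y0 F.
  apply: smooth_at_flat; apply: smooth_atB; first exact: smooth_at_cst.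
  by apply: smooth_at_sum => k; exact: smooth_atM.
have sL : smooth_at y0 L.
  by apply: smooth_at_sum => k; apply: smooth_atM => //; exact: smooth_at_cst.
rewrite /bump; under eq_fun do rewrite add0r.
rewrite -[LHS]/('D_v (fun z => F z * L z : R^o) y0) smooth_at_deriveM //.
have L0 : L y0 = 0 by rewrite /L big1 // => k _; rewrite subrr mul0r.
rewrite L0 mul0r addr0; congr (_ * _).
  by rewrite /F big1 ?subr0 // => k _; rewrite subrr expr0n.
rewrite smooth_at_derive_sum => [|k]; last first.
  by apply: smooth_atM => //; exact: smooth_at_cst.
apply: eq_bigr => k _; rewrite smooth_at_deriveM //; last exact: smooth_at_cst.
rewrite derive_cst mulr0 add0r mulrC; congr (_ * _).
rewrite smooth_at_deriveB; [|exact: smooth_at_coord|exact: smooth_at_cst].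
by rewrite derive_cst subr0 derive_coord.
Qed.

(** The support lies in a Euclidean ball; the surrounding cube is used because it is a product of
    segments, hence visibly compact. *)
Lemma bump_support y0 r d w z k : 0 < r -> bump y0 r d w z != 0 ->
  y0 0 k - r <= z 0 k <= y0 0 k + r.
Proof.
move=> r0; rewrite /bump mulf_eq0 negb_or => /andP[+ _].
have [le0|gt0] := leP (r ^+ 2 - \sum_k (z 0 k - y0 0 k) ^+ 2) 0.
  by rewrite flat_le0 // eqxx.
move=> _; have : (z 0 k - y0 0 k) ^+ 2 <= r ^+ 2.
  move: gt0; rewrite subr_gt0 => /ltW; apply: le_trans.
  by rewrite (bigD1 k) //= lerDl sumr_ge0 // => j _; exact: sqr_ge0.
rewrite -ler_sqrt ?sqr_ge0 ?exprn_ge0 ?(ltW r0) // !sqrtr_sqr (gtr0_norm r0).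
by rewrite ler_norml => /andP[h1 h2]; apply/andP; split; lra.
Qed.

Lemma compact_cube (y0 : E) (r : R) :
  compact [set z : E | forall k, `[y0 0 k - r, y0 0 k + r]%classic (z ord0 k)].
Proof.
apply: (rV_compact (A := fun k => `[y0 0 k - r, y0 0 k + r]%classic)) => k.
exact: segment_compact.
Qed.

Lemma cube_in_open (y0 : E) (U : set E) : open U -> U y0 -> exists2 r : R, 0 < r &
  [set z : E | forall k, `[y0 0 k - r, y0 0 k + r]%classic (z ord0 k)] `<=` U.
Proof.
move=> oU Uy; have /nbhs_ballP[e /= e0 eU] : nbhs y0 U by exact: open_nbhs_nbhs.
(* Balls of row vectors are open cubes, so halving the radius fits the closed cube inside. *)
exists (e / 2); first by rewrite divr_gt0.
move=> z hz; apply: eU; split => // i j; rewrite (ord1 i) /ball /= ltr_norml.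
by have := hz j; rewrite /= in_itv /= => /andP[h1 h2]; apply/andP; split; lra.
Qed.

End Bump.

Section TestSpinor.
Context {R : realType} {M : manifold R 2} {g : metric M} (S : spin_structure g).
Implicit Types (i j : chart M) (a b : gauge S) (x : M) (W : set M).

(** Since omega squares to -1, the matrices p + q omega multiply like the complex numbers p + i
    q. *)
Lemma spin_mxM (z w : R[i]) : spin_mx (z * w) = spin_mx z *m spin_mx w.
Proof.
rewrite /spin_mx ReM ImM.
have -> (x y u v : R) : (x * y - u * v)%:C = x%:C * y%:C - u%:C * v%:C.
  by rewrite rmorphB !rmorphM.
have -> (x y u v : R) : (x * y + u * v)%:C = x%:C * y%:C + u%:C * v%:C.
  by rewrite rmorphD !rmorphM.
move: (complex.Re z)%:C (complex.Im z)%:C (complex.Re w)%:C (complex.Im w)%:C => p q p' q'.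
rewrite mulmxDl !mulmxDr -!scalemxAl -!scalemxAr vol_mx2 !mul_scalar_mx !mul_mx_scalar.
rewrite -[p'%:M]scalemx1 -[(_ - _)%:M]scalemx1.
move: (vol_mx R) (1%:M : 'M[R[i]]_2) => V I; apply/matrixP => k l; rewrite !mxE.
by move: (V k l) (I k l) => ? ?; ring.
Qed.

Lemma spin_mx1 : spin_mx (1 : R[i]) = 1%:M.
Proof. by rewrite /spin_mx /= scale0r addr0. Qed.

Lemma spin_lift_refl a x : gdom a x -> spin_lift a a x = 1.
Proof.
move=> ax; have := spin_lift_cocycle ax ax ax.
have n1 := spin_lift_unit ax ax.
have z0 : spin_lift a a x != 0 by rewrite -normr_eq0 n1 oner_eq0.
by move=> /(congr1 (fun z => z / spin_lift a a x)); rewrite mulfK // divff.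
Qed.

(** In the gauge [a] this is the constant vector [v] times a cut-off written in the chart [i]; the
    other gauges receive it through the cocycle, and it is extended by zero. *)
Definition test_spinor i a (chi : 'rV[R]_2 -> R) (v : 'cV[R[i]]_2) : spinors S :=
  fun b y => if `[< dom M i y /\ gdom a y >]
             then (chi (coord M i y))%:C *: (spin_mx (spin_lift b a y) *m v) else 0.

Lemma test_spinor_self i a chi v y : dom M i y -> gdom a y ->
  test_spinor i a chi v a y = (chi (coord M i y))%:C *: v.
Proof.
move=> iy ay; rewrite /test_spinor asboolT //.
by rewrite spin_lift_refl // spin_mx1 mul1mx.
Qed.

(** The set [K], the image of the closed cube, is compact and therefore closed in the Hausdorff
    surface. A point outside the chart or the gauge domain thus has a neighbourhood disjoint from
    [K], on which the spinor is zero; inside both domains it is a product of smooth factors. *)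
Lemma test_spinor_section i a x W r d w v : dom M i x -> gdom a x -> 0 < r ->
  [set z : 'rV[R]_2 | forall k,
     `[coord M i x 0 k - r, coord M i x 0 k + r]%classic (z ord0 k)]
    `<=` coord M i @` (dom M i `&` gdom a) ->
  spinor_section W (test_spinor i a (bump (coord M i x) r d w) v).
Proof.
move=> ix ax r0 CU; set chi := bump _ _ _ _.
pose C := [set z : 'rV[R]_2 | forall k,
     `[coord M i x 0 k - r, coord M i x 0 k + r]%classic (z ord0 k)].
pose K := param M i @` C.
have cK : closed K.
  apply: compact_closed; first exact: points_hausdorff.
  apply: continuous_compact; last exact: compact_cube.
  apply: continuous_in_subspaceT => z /[!inE] /CU [y [iy ay] <-].
  by apply: param_continuous; exists y.
have chi0 y : dom M i y -> ~ K y -> chi (coord M i y) = 0.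
  move=> iy nKy; apply/eqP; apply: contraT => nz; exfalso; apply: nKy.
  exists (coord M i y); last exact: coordK.
  by move=> k /=; rewrite in_itv /=; exact: bump_support nz.
split; last first.
  move=> b b' y _ yb yb'; rewrite /test_spinor; case: asboolP => [[iy ay]|_].
    by rewrite -scalemxAr mulmxA -spin_mxM spin_lift_cocycle.
  by rewrite mulmx0.
move=> b s; apply: at_smooth_cfun => j y [_ yb] jy; set z0 := coord M j y.
have [[iy ay]|nU] := pselect (dom M i y /\ gdom a y); last first.
  have nKy : ~ K y.
    by move=> [z /CU [y' [iy' ay'] <-]]; rewrite coordK // => yy'; apply: nU; rewrite -yy'.
  apply: (csmooth_at_near_eq _ (csmooth_at_cst 0 z0)).
  have nK : \forall y' \near y, ~ K y'.
    by apply: open_nbhs_nbhs; split=> //; exact: closed_openC.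
  apply: filterS (near_param jy nK) => z nKz; rewrite /test_spinor.
  by case: asboolP => [[iz az]|_]; rewrite ?chi0 // ?scale0r mxE.
apply: (@csmooth_at_near_eq _ _ (fun z => (chi ((coord M i \o param M j) z))%:C *
    \sum_k ((complex.Re (spin_lift b a (param M j z)))%:C * ((s == k)%:R)
     + (complex.Im (spin_lift b a (param M j z)))%:C * vol_mx R s k) * v k 0)).
  have nU : \forall y' \near y, dom M i y' /\ gdom a y'.
    by apply: filterI; apply: open_nbhs_nbhs; split => //; [exact: dom_open | exact: gdom_open].
  apply: filterS (near_param jy nU) => z Uz; rewrite /test_spinor asboolT //.
  rewrite mxE [in RHS]mxE; congr (_ * _); apply: eq_bigr => k _; congr (_ * _).
  by rewrite [RHS]mxE; congr (_ + _); rewrite [RHS]mxE // mulr_natr.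
apply: csmooth_atM.
  by apply: csmooth_at_real; apply: bump_comp_smooth; exact: transition_smooth_at.
have oab : open (gdom b `&` gdom a) by apply: openI; exact: gdom_open.
have [sR sI] := smooth_cfun_at oab (spin_lift_smooth b a) (conj yb ay) jy.
apply: csmooth_at_sum => k; apply: csmooth_atM; last exact: csmooth_at_cst.
by apply: csmooth_atD; apply: csmooth_atM; [exact: csmooth_at_real | exact: csmooth_at_cst..
  | exact: csmooth_at_real | exact: csmooth_at_cst].
Qed.

End TestSpinor.

(** * The complex Clifford algebra of the plane *)

Section CliffordAlgebra.

Lemma sum_diff_eq0 (F : fieldType) (u a b : F) : (2 : F) != 0 -> u != 0 ->
  a + b * - u = 0 -> a + b * u = 0 -> a = 0 /\ b = 0.
Proof.
move=> n2 u0 h1 h2; split.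
  apply: (mulfI n2); rewrite mulr0 -[RHS](addr0 0) -{1}h1 -h2; ring.
apply: (mulfI (mulf_neq0 n2 u0)); rewrite mulr0 -[RHS](subr0 0) -{1}h2 -h1; ring.
Qed.

Lemma diff_sum_eq0 (F : fieldType) (u a b : F) : (2 : F) != 0 -> u != 0 ->
  - a + b * u = 0 -> a + b * u = 0 -> a = 0 /\ b = 0.
Proof.
move=> n2 u0 h1 h2; have h3 : a + b * - u = 0 by rewrite -[RHS]oppr0 -h1; ring.
exact: sum_diff_eq0 h3 h2.
Qed.

Context {R : realType}.

Lemma cliff0E : cliff R 0 = \matrix_(r, s) (if r == s then 0 else if r == 0 then -1 else 1).
Proof. by []. Qed.

Lemma cliff1E : cliff R 1 = \matrix_(r, s) (if r == s then 0 else 'i%C).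
Proof. by []. Qed.

Lemma vol_mxE :
  vol_mx R = \matrix_(r, s) (if r == s then if r == 0 then - 'i%C else 'i%C else 0).
Proof.
apply/matrixP => r s; rewrite /vol_mx !mxE !big_ord_recl !big_ord0 /cliff !mxE.
by case: r => [[|[|//]] ?]; case: s => [[|[|//]] ?]; rewrite ?mxE /=; simpc.
Qed.

Lemma cliff0_vol : cliff R 0 *m vol_mx R = - cliff R 1.
Proof.
rewrite vol_mxE; apply/matrixP => r s; rewrite !mxE !big_ord_recl !big_ord0 /cliff !mxE.
by case: r => [[|[|//]] ?]; case: s => [[|[|//]] ?]; rewrite ?mxE /=; simpc.
Qed.

Lemma cliff1_vol : cliff R 1 *m vol_mx R = cliff R 0.
Proof.
rewrite vol_mxE; apply/matrixP => r s; rewrite !mxE !big_ord_recl !big_ord0 /cliff !mxE.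
by case: r => [[|[|//]] ?]; case: s => [[|[|//]] ?]; rewrite ?mxE /=; simpc.
Qed.

Lemma cliff0_sqr : cliff R 0 *m cliff R 0 = - 1%:M.
Proof.
apply/matrixP => r s; rewrite !mxE !big_ord_recl !big_ord0 /cliff !mxE.
by case: r => [[|[|//]] ?]; case: s => [[|[|//]] ?]; rewrite ?mxE /=; simpc.
Qed.

(** The diagonal entries involve only [a0] and [a3], the others only [a1] and [a2]; in each pair the
    sum and the difference isolate the coefficients, as 2 and i are invertible. *)
Lemma clifford_independent (a0 a1 a2 a3 : R[i]) :
  a0%:M + a1 *: cliff R 0 + a2 *: cliff R 1 + a3 *: vol_mx R = 0 ->
  [/\ a0 = 0, a1 = 0, a2 = 0 & a3 = 0].
Proof.
rewrite vol_mxE cliff0E cliff1E => /matrixP E.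
have := E 0 0; have := E 1 1; have := E 0 1; have := E 1 0; rewrite !mxE /=.
rewrite !(mulr0, addr0, add0r, mulr1, mulr1n, mulr0n, mulrN1).
move=> h10 h01 h11 h00.
have i0 : 'i%C != 0 :> R[i] by rewrite eq_complex /= oner_eq0 andbF.
have n2 : (2 : R[i]) != 0 by rewrite pnatr_eq0.
have [a00 a30] := sum_diff_eq0 n2 i0 h00 h11.
by have [a10 a20] := diff_sum_eq0 n2 i0 h01 h10.
Qed.

(** Passes from the freedom to choose the spinor value or derivative at a point to an identity of
    matrices. *)
Lemma mulmx_col_eq0 (m n : nat) (A : 'M[R[i]]_(m, n)) :
  (forall v : 'cV_n, A *m v = 0) -> A = 0.
Proof.
move=> Av; apply/matrixP => r s; have := Av (delta_mx s 0); rewrite -colE.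
by move/matrixP => /(_ r 0); rewrite !mxE.
Qed.

End CliffordAlgebra.

(** * Comparison of coefficients at a point *)

Section Pointwise.
Context {R : realType} {M : manifold R 2} {g : metric M} {S : spin_structure g}.
Implicit Types (i : chart M) (a : gauge S) (x : M).

(** With [d] = 0 the spinor vanishes at the centre, so the connection term drops out and only the
    prescribed differential remains. *)
Lemma dirac_test_spinor i a x r w v : dom M i x -> gdom a x ->
  dirac i (test_spinor i a (bump (coord M i x) r 0 w) v) a x
  = \sum_(k < 2) (flat 0 (r ^+ 2) * \sum_l frame a k i x 0 l * w 0 l)%:C *: (cliff R k *m v).
Proof.
move=> ix ax; rewrite diracE; apply: eq_bigr => k _.
rewrite (test_spinor_self _ _ ix ax) bump_center mulr0 scale0r mulmx0 scaler0 addr0.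
rewrite scalemxAr; congr (_ *m _); apply/matrixP => s l; rewrite !mxE (ord1 l).
set X := frame a k i x; set chi := bump _ _ _ _.
rewrite -[LHS]/(cderive X (fun z => test_spinor i a chi v a (param M i z) s 0) (coord M i x)).
have -> : cderive X (fun z => test_spinor i a chi v a (param M i z) s 0) (coord M i x)
    = cderive X (fun z => v s 0 * (chi z)%:C) (coord M i x).
  apply: cderive_near_eq.
  have nU : \forall y \near x, dom M i y /\ gdom a y.
    by apply: filterI; apply: open_nbhs_nbhs; split => //; [exact: dom_open | exact: gdom_open].
  apply: filterS2 (near_param ix nU) (near_coordK ix) => z [iz az] zK.
  by rewrite test_spinor_self // zK mxE mulrC.
rewrite cderiveZ; last by apply: csmooth_at_real; exact: bump_smooth.
by rewrite cderive_real derive_bump_center mulrC.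
Qed.

Lemma factorization_pointwise W c eta H nA f h p q i a x :
  open W -> monic_factorization S W c eta H nA f h p q ->
  W x -> dom M i x -> gdom a x ->
  [/\ p x + f x = 0, h x = q x + 2 * eta,
      f x * p x - h x * q x = (nA x - H x ^+ 2 - 2 * c)%:C,
      h x * p x + f x * q x + 2 * eta * (H x)%:C = 0 &
      cdiff i p (frame a 0 i x) x = - cdiff i q (frame a 1 i x) x /\
      cdiff i p (frame a 1 i x) x = cdiff i q (frame a 0 i x) x].
Proof.
move=> oW fact Wx ix ax.
pose U := coord M i @` (dom M i `&` gdom a).
have oU : open U by apply: chart_image_open; exact: gdom_open.
have Ux : U (coord M i x) by exists x.
have [r r0 rU] := cube_in_open oU Ux.
pose psi d w v := test_spinor i a (bump (coord M i x) r d w) v.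
have spsi d w v : spinor_section W (psi d w v) by exact: test_spinor_section.
pose F0 : R[i] := (flat 0 (r ^+ 2))%:C.
have F00 : F0 != 0.
  by rewrite /F0 (inj_eq (@complexI _) _ 0) gt_eqF // flat_gt0 // exprn_gt0.
(* The covector dual to the first frame vector, so that D psi at the point is a nonzero multiple of
   e_1 . v. *)
pose w0 : 'rV[R]_2 := (invmx (frame_mx a i x) *m delta_mx 0 0)^T.
have w0E k : \sum_l frame a k i x 0 l * w0 0 l = (k == 0)%:R.
  have := mulKVmx (frame_mx_unit ax ix) (delta_mx 0 0 : 'cV_2).
  move=> /matrixP/(_ k 0); rewrite !mxE eqxx andbT => <-.
  by apply: eq_bigr => l _; rewrite !mxE.
have D0 v : dirac i (psi 0 w0 v) a x = F0 *: (cliff R 0 *m v).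
  rewrite dirac_test_spinor //; under eq_bigr do rewrite w0E.
  rewrite !big_ord_recl big_ord0 /= mulr1 mulr0.
  by rewrite scale0r !addr0.
have P0 v : psi 0 w0 v a x = 0.
  by rewrite /psi test_spinor_self // bump_center mulr0 scale0r.
have [pf hq] : p x + f x = 0 /\ h x - q x - 2 * eta = 0.
  have E : ((p x + f x)%:M + (h x - q x - 2 * eta) *: vol_mx R) *m cliff R 0 = 0.
    apply: mulmx_col_eq0 => v.
    have := factorization_first_order oW fact (spsi 0 w0 v) Wx ix ax.
    rewrite D0 P0 mulmx0 addr0 -scalemxAr !scalerA ![_ * F0]mulrC -!scalerA -scalerDr.
    move=> /eqP; rewrite scaler_eq0 (negbTE F00) /= => /eqP <-.
    by rewrite -mulmxA mulmxDl mul_scalar_mx -scalemxAl.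
  (* Clifford multiplication by e_1 squares to -1, so it can be cancelled on the right. *)
  move/(congr1 (fun B => B *m cliff R 0)): E.
  rewrite -mulmxA cliff0_sqr mulmxN mulmx1 mul0mx => /eqP; rewrite oppr_eq0 => /eqP E.
  have [] := @clifford_independent R (p x + f x) 0 0 (h x - q x - 2 * eta).
    by rewrite !scale0r !addr0.
  by [].
have hE : h x = q x + 2 * eta by apply/eqP; rewrite -subr_eq0 opprD addrA hq.
set dp := cdiff i p; set dq := cdiff i q.
(* The coefficients of D psi are now known to vanish, so only the value of the test spinor matters.
   The mixed differentials arise from e_1 omega = - e_2 and e_2 omega = e_1. *)
have E : (f x * p x - h x * q x - (nA x - H x ^+ 2 - 2 * c)%:C)%:M
    + (dp (frame a 0 i x) x + dq (frame a 1 i x) x) *: cliff R 0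
    + (dp (frame a 1 i x) x - dq (frame a 0 i x) x) *: cliff R 1
    + (h x * p x + f x * q x + 2 * eta * (H x)%:C) *: vol_mx R = 0.
  apply: mulmx_col_eq0 => v.
  have := factorization_first_order oW fact (spsi 1 0 v) Wx ix ax.
  rewrite pf hq !scale0r !add0r /psi test_spinor_self // bump_center mulr1.
  rewrite -scalemxAr => /eqP; rewrite scaler_eq0 -/F0 (negbTE F00) /= => /eqP <-.
  congr (_ *m _); rewrite !big_ord_recl big_ord0.
  have -> : lift ord0 ord0 = 1 :> 'I_2 by apply/val_inj.
  rewrite cliff0_vol cliff1_vol -/dp -/dq.
  move: (cliff R 0) (cliff R 1) (vol_mx R) (_%:M) => c0 c1 o K.
  by apply/matrixP => k l; rewrite !mxE; ring.
have [e0 e1 e2 e3] := clifford_independent E.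
split; [exact: pf | exact: hE | exact: subr0_eq e0 | exact: e3 |].
by split; [apply/eqP; rewrite -addr_eq0 e1 | exact: subr0_eq e2].
Qed.

End Pointwise.

(** * Gradients and the Laplacian *)

Lemma bilDl (R : realType) n (G : 'M[R]_n) u u' v : bil G (u + u') v = bil G u v + bil G u' v.
Proof. by rewrite /bil !mulmxDl mxE. Qed.

Lemma bil_sym (R : realType) n (G : 'M[R]_n) u v : G^T = G -> bil G u v = bil G v u.
Proof.
move=> sG; rewrite /bil; have -> : u *m G *m v^T = (v *m G *m u^T)^T.
  by rewrite !trmx_mul trmxK sG mulmxA.
by rewrite mxE.
Qed.

Lemma bil_matrixP (R : realType) n (G G' : 'M[R]_n) :
  (forall u v, bil G u v = bil G' u v) -> G = G'.
Proof.
move=> E; apply/matrixP => k l; have := E (delta_mx 0 k) (delta_mx 0 l).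
by rewrite /bil -!rowE !trmx_delta -!colE !mxE.
Qed.

(** * The Koszul formula and its consequences *)

Section Koszul.
Context {R : realType} {n : nat} {M : manifold R n} (g : metric M).
Implicit Types (i : chart M) (x : M) (u v w : 'rV[R]_n).

Lemma pdiff_gram_sym i u x : dom M i x -> (pdiff i (g i) u x)^T = pdiff i (g i) u x.
Proof.
move=> ix; have sG : smooth_mx_at (coord M i x) (g i \o param M i) by exact: gram_smooth_at.
apply/matrixP => l m; rewrite mxE /pdiff !smooth_mx_at_entry //; apply: near_eq_derive.
have nd := near_param ix (near_dom ix); apply: filterS nd => z iz /=.
by have /matrixP/(_ l m) := gram_sym g iz; rewrite mxE.
Qed.

Lemma pdiff_gram_bil i x u v w : dom M i x ->
  bil (pdiff i (g i) w x) u v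
  = \sum_l bil (pdiff i (g i) (delta_mx 0 l) x) u v * w 0 l.
Proof.
move=> ix; have sG : smooth_mx_at (coord M i x) (g i \o param M i) by exact: gram_smooth_at.
pose T l : 'M[R]_n := pdiff i (g i) (delta_mx 0 l) x.
rewrite -[RHS]/(\sum_l bil (T l) u v * w 0 l).
have -> : pdiff i (g i) w x = \sum_l w 0 l *: T l.
  apply/matrixP => k m; rewrite /pdiff smooth_mx_at_entry // derive_coordE.
    rewrite summxE; apply: eq_bigr => l _.
    by rewrite [RHS]mxE /T smooth_mx_at_entry.
  exact: smooth_at_differentiable.
rewrite /bil mulmx_sumr mulmx_suml summxE; apply: eq_bigr => l _.
by rewrite -scalemxAr -scalemxAl mxE mulrC.
Qed.

Lemma christoffel_gram i x u v w : dom M i x ->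
  bil (g i x) (christoffel g i u v x) w
  = 2^-1 * (bil (pdiff i (g i) u x) v w + bil (pdiff i (g i) v x) u w
            - bil (pdiff i (g i) w x) u v).
Proof.
have E (Tu Tv : 'M[R]_n) (T : 'I_n -> 'M[R]_n) :
    ((v *m Tu + u *m Tv - \row_k bil (T k) u v) *m w^T) 0 0
    = bil Tu v w + bil Tv u w - \sum_l bil (T l) u v * w 0 l.
  rewrite mulmxBl mulmxDl mxE [X in _ + X]mxE mxE; congr (_ - _).
  by rewrite mxE; apply: eq_bigr => l _; rewrite !mxE.
move=> ix; rewrite (pdiff_gram_bil u v w ix) -(E _ _ (fun k => pdiff i (g i) (delta_mx 0 k) x)).
rewrite {1}/bil /christoffel -!scalemxAl mxE mulmxKV ?gram_unit //.
Qed.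

Lemma christoffel_sym i x u v : dom M i x -> christoffel g i u v x = christoffel g i v u x.
Proof.
have E (Tu Tv I : 'M[R]_n) (T : 'I_n -> 'M[R]_n) : (forall k, (T k)^T = T k) ->
    2^-1 *: ((v *m Tu + u *m Tv - \row_k bil (T k) u v) *m I)
    = 2^-1 *: ((u *m Tv + v *m Tu - \row_k bil (T k) v u) *m I).
  move=> sT; rewrite [v *m _ + _]addrC; congr (_ *: ((_ - _) *m _)).
  by apply/rowP => k; rewrite !mxE bil_sym.
move=> ix; apply: (E _ _ _ (fun k => pdiff i (g i) (delta_mx 0 k) x)) => k.
exact: pdiff_gram_sym.
Qed.

(** In the sum of the two Koszul expressions the terms that differentiate along [v] and [w] cancel,
    and the two equal ones along [u] absorb the factor one half. *)
Lemma metric_compatibility i x u v w : dom M i x ->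
  bil (pdiff i (g i) u x) v w
  = bil (g i x) (christoffel g i u v x) w + bil (g i x) v (christoffel g i u w x).
Proof.
move=> ix; pose B u v w := bil (pdiff i (g i) u x) v w.
have sB u' v' w' : B u' v' w' = B u' w' v' by apply: bil_sym; exact: pdiff_gram_sym.
have cB u' v' w' : bil (g i x) (christoffel g i u' v' x) w'
    = 2^-1 * (B u' v' w' + B v' u' w' - B w' u' v') by exact: christoffel_gram.
rewrite -[LHS]/(B u v w) [bil (g i x) v _]bil_sym ?gram_sym // !cB.
move: B sB {cB} => B sB; rewrite (sB u w v).
by field.
Qed.

End Koszul.

(** * Linear algebra in dimension two *)

Section Plane.
Context {F : comUnitRingType}.

Definition rot2 : 'M[F]_2 := \matrix_(k, l) ((k < l)%N%:R - (l < k)%N%:R).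

Lemma sum_I2 (V : nmodType) (f : 'I_2 -> V) : \sum_k f k = f 0 + f 1.
Proof.
rewrite !big_ord_recl big_ord0 addr0; congr (_ + f _); exact/val_inj.
Qed.

Lemma matrix2P (T : Type) (A B : 'M[T]_2) :
  A 0 0 = B 0 0 -> A 0 1 = B 0 1 -> A 1 0 = B 1 0 -> A 1 1 = B 1 1 -> A = B.
Proof.
have E (k : 'I_2) : k = 0 \/ k = 1.
  by case: k => [[|[|//]] ?]; [left|right]; exact/val_inj.
move=> h00 h01 h10 h11; apply/matrixP => k l.
by case: (E k) => ->; case: (E l) => ->.
Qed.

Lemma row2P (T : Type) (u v : 'rV[T]_2) : u 0 0 = v 0 0 -> u 0 1 = v 0 1 -> u = v.
Proof.
move=> h0 h1; apply/rowP; case=> [[|[|//]] ?].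
  by rewrite (_ : Ordinal _ = 0) //; exact/val_inj.
by rewrite (_ : Ordinal _ = 1) //; exact/val_inj.
Qed.

Lemma det2 (A : 'M[F]_2) : \det A = A 0 0 * A 1 1 - A 0 1 * A 1 0.
Proof.
rewrite (expand_det_row _ 0) sum_I2 /cofactor !det_mx11 !mxE /=.
have -> : lift 0 0 = 1 :> 'I_2 by exact/val_inj.
have -> : lift 1 0 = 0 :> 'I_2 by exact/val_inj.
by rewrite !addn0 !add0n expr0 expr1 mul1r mulN1r mulrN.
Qed.

Lemma mul_rot2 (u : 'rV[F]_2) :
  (u *m rot2) 0 0 = - u 0 1 /\ (u *m rot2) 0 1 = u 0 0.
Proof. by rewrite !(mxE, sum_I2) /=; split; ring. Qed.

(** Alternating forms on the plane make up a line, on which a change of basis acts by its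
    determinant. This removes the metric from formulas for J up to the area density. *)
Lemma rot2_congr (P : 'M[F]_2) : P *m rot2 *m P^T = \det P *: rot2.
Proof.
by apply: matrix2P; rewrite !(mxE, sum_I2) det2 /=; ring.
Qed.

Lemma rot2_tr_congr (P : 'M[F]_2) : P^T *m rot2 *m P = \det P *: rot2.
Proof. by rewrite -{2}[P]trmxK rot2_congr det_tr. Qed.

Lemma inv2 (A : 'M[F]_2) : A \in unitmx -> invmx A =
  (\det A)^-1 *: \matrix_(k, l) (if k == l then A (1 - k) (1 - l) else - A k l).
Proof.
move=> uA; have dA : \det A \is a GRing.unit by rewrite -unitmxE.
set B := _ *: _; suff AB : A *m B = 1%:M by rewrite -[RHS](mulKmx uA) AB mulmx1.
have e1 : (1 - 1 : 'I_2) = 0 by exact/val_inj.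
have e0 : (1 - 0 : 'I_2) = 1 by exact/val_inj.
have dV := mulVr dA; rewrite det2 in dV.
by apply: matrix2P; rewrite !(mxE, sum_I2) /= ?e1 ?e0 det2 -?dV; ring.
Qed.

End Plane.

(* The first and third terms cancel in the trace of u |-> Gamma(u, v). *)
Lemma trace_contraction (F : comPzRingType) n (T : 'I_n -> 'M[F]_n) (Tv I : 'M[F]_n)
    (v : 'rV[F]_n) : (forall k, (T k)^T = T k) -> I^T = I ->
  \sum_k ((v *m T k + delta_mx 0 k *m Tv
            - \row_l ((delta_mx 0 k : 'rV_n) *m T l *m v^T) 0 0) *m I) 0 k = \tr (Tv *m I).
Proof.
move=> symT symI.
have dE (A : 'M[F]_n) k l : ((delta_mx 0 k : 'rV_n) *m A) 0 l = A k l.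
  by rewrite -rowE mxE.
under eq_bigr do rewrite mulmxBl mulmxDl !mxE.
rewrite sumrB big_split /= addrAC addrC [X in _ + X](_ : _ = 0).
  by rewrite addr0 /mxtrace; apply: eq_bigr => k _; rewrite mxE; apply: eq_bigr => l _;
    rewrite dE.
apply/eqP; rewrite subr_eq0; apply/eqP.
rewrite exchange_big /=; apply: eq_bigr => k _; apply: eq_bigr => l _.
have Ikl : I l k = I k l by rewrite -{1}symI mxE.
rewrite [in RHS]mxE Ikl; congr (_ * _).
rewrite mxE [RHS]mxE; apply: eq_bigr => m _; rewrite dE [in LHS]mulrC mxE; congr (_ * _).
by rewrite -{1}(symT l) mxE.
Qed.

(** * Rotated gradients and the area density *)

Section JGradient.
Context {R : realType} {M : manifold R 2} {g : metric M} (S : spin_structure g).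
Implicit Types (i : chart M) (a : gauge S) (x : M) (f h : M -> R).

(** Determinants in P g P^T = 1 give this up to sign, and the orientation of the frame fixes the
    sign. The square root in [quarter_turn] is thereby traded for the polynomial det P. *)
Lemma sqrt_det_gram i a x : gdom a x -> dom M i x ->
  Num.sqrt (\det (g i x)) * \det (frame_mx a i x) = 1.
Proof.
move=> ax ix; set P := frame_mx a i x.
have dP : 0 < \det P by exact: frame_oriented.
have := congr1 determinant (frame_gram ax ix).
rewrite !det_mulmx det_tr det1 mulrAC -expr2 -/P => e.
have -> : \det (g i x) = (\det P)^-1 ^+ 2.
  have n0 : \det P ^+ 2 != 0 by rewrite expf_neq0 // gt_eqF.
  by apply: (mulfI n0); rewrite e exprVn divff.
by rewrite sqrtr_sqr ger0_norm ?invr_ge0 ?(ltW dP) // mulVf // gt_eqF.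
Qed.

Definition differential i f x : 'rV[R]_2 :=
  \row_k pdiff i (f : M -> R^o) (delta_mx 0 k) x.

Lemma pdiff_differential i f x v :
  smooth_at (coord M i x) (fun z => f (param M i z)) ->
  pdiff i (f : M -> R^o) v x = \sum_k v 0 k * differential i f x 0 k.
Proof.
move=> /smooth_at_differentiable df; rewrite /pdiff derive_coordE //.
by apply: eq_bigr => k _; rewrite mxE.
Qed.

(** Raising an index and then applying J involves the inverse metric on both sides of [rot2], and
    such a congruence is a mere rescaling. *)
Lemma quarter_turn_gram i a x : gdom a x -> dom M i x ->
  invmx (g i x) *m quarter_turn g i x = \det (frame_mx a i x) *: rot2.
Proof.
move=> ax ix; rewrite /quarter_turn -/rot2 -scalemxAr (frame_gram_inv ax ix).
set P := frame_mx a i x; have := sqrt_det_gram ax ix; rewrite -/P => sd.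
rewrite -!mulmxA [P *m (rot2 *m _)]mulmxA [_ *m (P^T *m P)]mulmxA rot2_congr.
rewrite -scalemxAl -scalemxAr scalerA sd scale1r mulmxA rot2_tr_congr.
by [].
Qed.

(** In a positively oriented orthonormal frame J is the standard rotation, so the Cauchy-Riemann
    equations in the frame amount to the tensor identity in the chart. *)
Lemma grad_quarter_turn i a x f h : gdom a x -> dom M i x ->
  smooth_at (coord M i x) (fun z => f (param M i z)) ->
  smooth_at (coord M i x) (fun z => h (param M i z)) ->
  pdiff i (h : M -> R^o) (frame a 0 i x) x = - pdiff i (f : M -> R^o) (frame a 1 i x) x ->
  pdiff i (h : M -> R^o) (frame a 1 i x) x = pdiff i (f : M -> R^o) (frame a 0 i x) x ->
  grad g i h x = grad g i f x *m quarter_turn g i x.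
Proof.
move=> ax ix sf sh; rewrite !(pdiff_differential _ sf) !(pdiff_differential _ sh) => h0 h1.
rewrite /grad -!/(differential _ _ _) -[RHS]mulmxA (quarter_turn_gram ax ix).
set df := differential i f x in h0 h1 *; set dh := differential i h x in h0 h1 *.
set P := frame_mx a i x.
have PT : dh *m P^T = df *m P^T *m rot2.
  have frE (d : 'rV[R]_2) k : (d *m P^T) 0 k = \sum_l frame a k i x 0 l * d 0 l.
    by rewrite mxE; apply: eq_bigr => l _; rewrite !mxE mulrC.
  have [r0 r1] := mul_rot2 (df *m P^T).
  by apply: row2P; [rewrite r0 | rewrite r1]; rewrite !frE.
rewrite (frame_gram_inv ax ix) -/P mulmxA PT -!mulmxA.
by rewrite [P^T *m (rot2 *m P)]mulmxA rot2_tr_congr.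
Qed.

Lemma grad_rot2 i a x f h : gdom a x -> dom M i x ->
  grad g i h x = grad g i f x *m quarter_turn g i x ->
  grad g i h x = \det (frame_mx a i x) *: (differential i f x *m rot2).
Proof.
move=> ax ix ->; rewrite /grad -/(differential _ _ _) -mulmxA (quarter_turn_gram ax ix).
by rewrite -scalemxAr.
Qed.

Lemma det_smooth_at n (F : 'rV[R]_n -> 'M[R]_2) y : smooth_mx_at y F ->
  smooth_at y (fun z => \det (F z)).
Proof.
by move=> sF; under eq_fun do rewrite det2; apply: smooth_atB; apply: smooth_atM.
Qed.

(** Jacobi's formula, read off from the adjugate, which in dimension two is explicit. *)
Lemma derive_det2 n (F : 'rV[R]_n -> 'M[R]_2) y v : smooth_mx_at y F ->
  F y \in unitmx ->
  'D_v (fun z => \det (F z) : R^o) y = \det (F y) * \tr ('D_v F y *m invmx (F y)).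
Proof.
move=> sF uF; have dF k l : derivable (fun z => F z k l : R^o) y v.
  exact: smooth_at_derivable.
have -> : 'D_v (fun z => \det (F z) : R^o) y =
  F y 0 0 * 'D_v F y 1 1 + F y 1 1 * 'D_v F y 0 0
  - (F y 0 1 * 'D_v F y 1 0 + F y 1 0 * 'D_v F y 0 1) :> R.
  under eq_fun do rewrite det2.
  rewrite smooth_at_deriveB; [|exact: smooth_atM..].
  by rewrite !smooth_at_deriveM // !smooth_mx_at_entry.
have dn0 : \det (F y) != 0 by move: uF; rewrite unitmxE unitfE.
rewrite inv2 // -scalemxAr mxtraceZ mulVKf //.
have e1 : (1 - 1 : 'I_2) = 0 by exact/val_inj.
have e0 : (1 - 0 : 'I_2) = 1 by exact/val_inj.
rewrite /mxtrace !(mxE, sum_I2) /= ?e1 ?e0.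
by move: ('D_v F y) => G; ring.
Qed.

(** Obtained by differentiating (det P)^2 det g = 1 and using Jacobi's formula for det g. *)
Lemma derive_det_frame i a x v : gdom a x -> dom M i x ->
  let y := coord M i x in let G := g i \o param M i in
  'D_v (fun z => \det (frame_mx a i (param M i z)) : R^o) y
  = - 2^-1 * \det (frame_mx a i x) * \tr ('D_v G y *m invmx (G y)) :> R.
Proof.
move=> ax ix y G; pose P z := frame_mx a i (param M i z).
have xK : param M i y = x by exact: coordK.
have sP : smooth_mx_at y P by exact: frame_mx_smooth_at.
have sG : smooth_mx_at y G by exact: gram_smooth_at.
have uG : G y \in unitmx by rewrite /G /= xK gram_unit.
pose d z : R := \det (P z); pose e z : R := \det (G z).
have sd : smooth_at y d by exact: det_smooth_at.
have se : smooth_at y e by exact: det_smooth_at.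
have nU : \forall z \near y, d z * d z * e z = 1.
  have nU : \forall y' \near x, dom M i y' /\ gdom a y'.
    by apply: filterI; apply: open_nbhs_nbhs; split => //; [exact: dom_open | exact: gdom_open].
  apply: filterS (near_param ix nU) => z [iz az].
  have := congr1 determinant (frame_gram az iz).
  by rewrite !det_mulmx det_tr det1 mulrAC.
have sdd : smooth_at y (fun z => d z * d z) by exact: smooth_atM.
have : 'D_v (fun z => d z * d z * e z : R^o) y = 0.
  by rewrite (@near_eq_derive _ _ _ _ (cst (1 : R^o)) y v nU) derive_cst.
rewrite smooth_at_deriveM // smooth_at_deriveM // (derive_det2 _ sG uG) -/(e y).
have dy : d y = \det (frame_mx a i x) by rewrite /d /P xK.
rewrite -dy; have ne0 := nbhs_singleton nU.
move: (\tr _) ('D_v d y) => t dd' E.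
have de0 : d y * e y != 0.
  by apply/eqP => z0; move: ne0; rewrite -mulrA z0 mulr0 => /eqP; rewrite eq_sym oner_eq0.
move: (d y) (e y) de0 E {dy ne0} => u w de0 E.
have n2 : (2 : R) != 0 by rewrite pnatr_eq0.
apply: (mulfI (mulf_neq0 n2 de0)).
apply/eqP; rewrite -subr_eq0; apply/eqP; by rewrite -[RHS]E; field.
Qed.

(** The right side is the logarithmic derivative of sqrt(det g), the opposite of that of det P; this
    is why the two cancel in a divergence. *)
Lemma christoffel_trace i x v : dom M i x ->
  \sum_k christoffel g i (delta_mx 0 k) v x 0 k
  = 2^-1 * \tr (pdiff i (g i) v x *m invmx (g i x)).
Proof.
move=> ix; set I := invmx (g i x).
rewrite -(trace_contraction (T := fun k => pdiff i (g i) (delta_mx 0 k) x) _ v).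
- rewrite mulr_sumr; apply: eq_bigr => k _; rewrite /christoffel mxE -/I /bil.
  exact: erefl.
- by move=> k; exact: pdiff_gram_sym.
- by rewrite /I trmx_inv gram_sym.
Qed.

(** The divergence of a field X is d_k (sqrt(det g) X^k) / sqrt(det g). For J grad f the density
    cancels the factor det P, leaving the difference of the two mixed second derivatives of f. *)
Lemma laplacian_rot_grad i a x (W : set M) f h : open W -> W x ->
  gdom a x -> dom M i x ->
  smooth_at (coord M i x) (fun z => f (param M i z)) ->
  (forall y, W y -> gdom a y -> dom M i y ->
     grad g i h y = grad g i f y *m quarter_turn g i y) ->
  laplacian g i h x = 0.
Proof.
move=> oW Wx ax ix sf gradE; set y := coord M i x.
have xK : param M i y = x by exact: coordK.
pose F z : R^o := f (param M i z).
pose D z : R^o := \det (frame_mx a i (param M i z)).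
(* The components of J grad f; unlike [grad g i h], they are smooth by construction. *)
pose Q z : 'rV[R]_2 := \row_k (if k == 0 then (- D z : R) * 'D_(delta_mx 0 1) F z
   else (D z : R) * 'D_(delta_mx 0 0) F z).
have sD : smooth_at y D by apply: det_smooth_at; exact: frame_mx_smooth_at.
have sQ : smooth_mx_at y Q.
  move=> r k; under eq_fun do rewrite mxE; case: (k == 0).
    by apply: smooth_atM; [exact: smooth_atN | exact: smooth_at_derive].
  by apply: smooth_atM => //; exact: smooth_at_derive.
have nQ : \forall z \near y, grad g i h (param M i z) = Q z.
  have nU : \forall y' \near x, dom M i y' /\ gdom a y' /\ W y'.
    apply: filterI; first exact: near_dom.
    by apply: filterI; apply: open_nbhs_nbhs; split => //; exact: gdom_open.
  apply: filterS2 (near_coordK ix) (near_param ix nU) => z zK [iz [az Wz]].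
  rewrite (grad_rot2 az iz (gradE _ Wz az iz)) -/(D z).
  have [r0 r1] := mul_rot2 (differential i f (param M i z)).
  apply: row2P; rewrite mxE ?r0 ?r1 [RHS]mxE /= mxE /pdiff zK ?mulrN ?mulNr; exact: erefl.
have Qx : grad g i h x = Q y by have := nbhs_singleton nQ; rewrite xK.
have -> : laplacian g i h x = \sum_k pdiff i (grad g i h) (delta_mx 0 k) x 0 k
    + \sum_k christoffel g i (delta_mx 0 k) (Q y) x 0 k.
  by rewrite -big_split /= -Qx; apply: eq_bigr => k _; rewrite /nabla mxE.
rewrite christoffel_trace //.
have dQ k : pdiff i (grad g i h) (delta_mx 0 k) x 0 k
    = 'D_(delta_mx 0 k) (fun z => Q z 0 k : R^o) y.
  by rewrite /pdiff -/y (near_eq_derive _ nQ) smooth_mx_at_entry.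
have sDk k : smooth_at y ('D_(delta_mx 0 k) F) by exact: smooth_at_derive.
have dQ0 : pdiff i (grad g i h) (delta_mx 0 0) x 0 0 =
    - D y * 'D_(delta_mx 0 0) ('D_(delta_mx 0 1) F) y
    - 'D_(delta_mx 0 1) F y * 'D_(delta_mx 0 0) D y :> R.
  rewrite dQ (_ : (fun z => _) = (fun z => (- D z : R) * 'D_(delta_mx 0 1) F z)); last first.
    by apply/funext => z; rewrite mxE.
  by rewrite smooth_at_deriveM ?smooth_at_deriveN ?mulrN //; exact: smooth_atN.
have dQ1 : pdiff i (grad g i h) (delta_mx 0 1) x 0 1 =
    D y * 'D_(delta_mx 0 1) ('D_(delta_mx 0 0) F) y
    + 'D_(delta_mx 0 0) F y * 'D_(delta_mx 0 1) D y :> R.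
  rewrite dQ (_ : (fun z => _) = (fun z => (D z : R) * 'D_(delta_mx 0 0) F z)); last first.
    by apply/funext => z; rewrite mxE.
  by rewrite smooth_at_deriveM.
have sG : smooth_mx_at y (g i \o param M i) by exact: gram_smooth_at.
pose T k : 'M[R]_2 := 'D_(delta_mx 0 k) (g i \o param M i) y.
have trE : \tr (pdiff i (g i) (Q y) x *m invmx (g i x)) =
    Q y 0 0 * \tr (T 0 *m invmx (g i x)) + Q y 0 1 * \tr (T 1 *m invmx (g i x)).
  have -> : pdiff i (g i) (Q y) x = Q y 0 0 *: T 0 + Q y 0 1 *: T 1.
    apply/matrixP => k l; rewrite /pdiff -/y smooth_mx_at_entry // derive_coordE.
      rewrite sum_I2 [RHS]mxE; congr (_ + _); rewrite [RHS]mxE /T smooth_mx_at_entry //.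
    exact: smooth_at_differentiable.
  move: (T 0) (T 1) (invmx _) => T0 T1 I.
  by rewrite mulmxDl mxtraceD -!scalemxAl !mxtraceZ.
have Q0 : Q y 0 0 = - (D y * 'D_(delta_mx 0 1) F y) by rewrite mxE /= mulNr.
have Q1 : Q y 0 1 = D y * 'D_(delta_mx 0 0) F y by rewrite mxE.
have dD' k : 'D_(delta_mx 0 k) D y = - 2^-1 * D y * \tr (T k *m invmx (g i x)) :> R.
  have /= := derive_det_frame (delta_mx 0 k) ax ix; rewrite -/y -/D => ->.
  by rewrite /T /D xK.
have sw : 'D_(delta_mx 0 1) ('D_(delta_mx 0 0) F) y = 'D_(delta_mx 0 0) ('D_(delta_mx 0 1) F) y.
  exact: smooth_at_swap.
rewrite sum_I2 trE [X in X + _ + _]dQ0 [X in _ + X + _]dQ1 Q0 Q1 !dD' sw.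
have fin (d0 b0 b1 b01 t0 t1 : R) :
    - d0 * b01 - b1 * (- 2^-1 * d0 * t0) + (d0 * b01 + b0 * (- 2^-1 * d0 * t1))
    + 2^-1 * (- (d0 * b1) * t0 + d0 * b0 * t1) = 0 by field.
exact: fin.
Qed.

End JGradient.

(** * The shape operator *)

(** Here [v] stands for a tangent vector dphi v, [s] for its derivative, [T] for the derivative of
    the ambient metric, [z] for xi, and [- a - c] for the derivative of xi, with [a] = dphi(A w) and
    [c] the Christoffel term. *)
Lemma second_fundamental_form_algebra (R : realType) n (s v z a c : 'rV[R]_n) (G T : 'M[R]_n) :
  (s *m G + v *m T) *m z^T + v *m G *m (- a - c)^T = 0 ->
  bil G v a = bil G s z + bil T v z - bil G v c.
Proof.
move/matrixP/(_ 0 0); rewrite mulmxDl -opprD linearN linearD /= mulmxN mulmxDr.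
rewrite mxE [X in X + _]mxE [X in _ + X]mxE [X in _ - X]mxE [RHS]mxE -!/(bil _ _ _) => E.
by apply/eqP; rewrite -subr_eq0 -oppr_eq0 -[X in _ == X]E; apply/eqP; ring.
Qed.

Section ShapeOperator.
Context {R : realType} {M : manifold R 2} {N : manifold R 3}.
Context (g : metric M) (gN : metric N) (phi : M -> N).
Context (xi : chart N -> M -> 'rV[R]_3) (A : chart M -> M -> 'M[R]_2).
Hypotheses (hphi : isometric_immersion g gN phi) (hxi : unit_normal gN phi xi).
Hypothesis hA : shape_operator gN phi xi A.

(* Differentiate <dphi v, xi> = 0: the second fundamental form is the normal part of
   the second derivative of phi, which is symmetric. *)
Lemma second_fundamental_form i k x (v w : 'rV[R]_2) : dom M i x -> dom N k (phi x) ->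
  let F := coord N k \o phi \o param M i in
  bil (g i x) v (w *m A i x)
  = bil (gN k (phi x)) ('D_w ('D_v F) (coord M i x)
      + christoffel gN k (w *m dmap phi i k x) (v *m dmap phi i k x) (phi x)) (xi k x).
Proof.
move=> ix kx F; set y := coord M i x.
have [cphi sphi isom] := hphi; have [sxi _ _ nxi] := hxi; have [_ dxi] := hA.
have xK : param M i y = x by exact: coordK.
have oW : open (phi @^-1` dom N k).
  by move/continuousP : cphi; apply; exact: dom_open.
pose U := coord M i @` (dom M i `&` phi @^-1` dom N k).
have oU : open U by exact: chart_image_open.
have Uy : U y by exists x.
have nU : \forall z \near y, U z by exact: open_nbhs_nbhs.
have dF z : U z -> differentiable F z by exact: smooth_on_differentiable (sphi i k).
have sF : smooth_mx_at y F by exact: smooth_on_mx_at oU (sphi i k) Uy.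
pose V := 'D_v F; pose X z := xi k (param M i z); pose G z := gN k (phi (param M i z)).
have sV : smooth_mx_at y V by exact: smooth_mx_at_derive.
have sX : smooth_mx_at y X by exact: (smooth_in_at oW (sxi i k) kx ix).
have dV : derivable V y w by exact: smooth_mx_at_derivable.
have dX : derivable X y w by exact: smooth_mx_at_derivable.
have Fy : F y = coord N k (phi x) by rewrite /F /= xK.
pose GN := gN k \o param N k.
have sGN : smooth_mx_at (F y) GN by rewrite Fy; exact: gram_smooth_at.
have GE : {near y, GN \o F =1 G}.
  by apply: filterS nU => _ [x' [ix' kx'] <-]; rewrite /GN /F /G /= coordK // coordK.
have GNE a b : 'D_w (fun z => (GN \o F) z a b : R^o) y
    = 'D_(w *m dmap phi i k x) (fun z => GN z a b : R^o) (F y)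
  /\ derivable (fun z => (GN \o F) z a b : R^o) y w.
  have dg : differentiable (fun z => GN z a b : R^o) (F y).
    exact: smooth_at_differentiable (sGN a b).
  have dgF : differentiable ((fun z => GN z a b : R^o) \o F) y.
    by apply: differentiable_comp => //; exact: dF.
  split; last exact: diff_derivable.
  rewrite -[LHS]/('D_w ((fun z => GN z a b : R^o) \o F) y) deriveE //.
  rewrite diff_comp //=; last exact: dF.
  by rewrite /dmap -/y -deriveEjacobian ?deriveE //; exact: dF.
have dGF : derivable (GN \o F) y w.
  by apply/derivable_mxP => a b; have [] := GNE a b.
have dG : derivable G y w by exact: near_eq_derivable GE dGF.
have DG : 'D_w G y = pdiff k (gN k) (w *m dmap phi i k x) (phi x).
  rewrite -(@near_eq_derive _ _ _ (GN \o F) G y w GE).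
  transitivity ('D_(w *m dmap phi i k x) GN (F y)); last by rewrite Fy.
  apply/matrixP => a b; rewrite (derive_mx dGF) [LHS]mxE (GNE a b).1.
  by symmetry; exact: smooth_mx_at_entry.
have VE z : U z -> V z = v *m dmap phi i k (param M i z).
  move=> [x' [ix' kx'] <-]; rewrite /dmap coordK // -deriveEjacobian //.
  by apply: dF; exists x'.
have E0 : 'D_w (fun z => V z *m G z *m (X z)^T) y = 0.
  rewrite (@near_eq_derive _ _ _ _ (cst 0) y w) ?derive_cst //.
  apply: filterS nU => z Uz; rewrite (VE z Uz).
  case: Uz => x' [ix' kx'] <-; rewrite /G /X coordK //.
  by apply/matrixP => a b; rewrite (ord1 a) (ord1 b) [RHS]mxE; exact: nxi.
have dVG := is_derive_mulmx dV dG.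
have dXT := derive_trmx dX.
have dVGX := is_derive_mulmx (@ex_derive _ _ _ _ _ _ _ dVG) (@ex_derive _ _ _ _ _ _ _ dXT).
move: E0; rewrite (@derive_val _ _ _ _ _ _ _ dVGX) (@derive_val _ _ _ _ _ _ _ dVG).
rewrite (@derive_val _ _ _ _ _ _ _ dXT).
have -> : 'D_w X y = - (w *m A i x *m dmap phi i k x)
    - christoffel gN k (w *m dmap phi i k x) (xi k x) (phi x).
  by rewrite -dxi // addrK.
rewrite DG (VE y Uy) /G /X xK => /second_fundamental_form_algebra E.
have -> : bil (g i x) v (w *m A i x)
    = bil (gN k (phi x)) (v *m dmap phi i k x) (w *m A i x *m dmap phi i k x).
  by rewrite (isom i k x ix kx) /bil !trmx_mul !mulmxA.
(* Metric compatibility splits the derivative of the ambient metric into two Christoffel terms, one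
   of which cancels the term from the covariant derivative of xi. *)
by rewrite E bilDl (metric_compatibility gN _ _ _ kx) addrA addrK.
Qed.

Lemma shape_operator_sym i x : dom M i x -> (A i x *m g i x)^T = A i x *m g i x.
Proof.
move=> ix; pose k := chart_at N (phi x).
have kx : dom N k (phi x) by exact: mem_chart_at.
have [cphi sphi _] := hphi.
have sF : smooth_mx_at (coord M i x) (coord N k \o phi \o param M i).
  have oW : open (phi @^-1` dom N k) by move/continuousP : cphi; apply; exact: dom_open.
  apply: (smooth_on_mx_at (chart_image_open oW) (sphi i k)); by exists x.
pose F : 'rV[R]_2 -> 'rV[R]_3 := coord N k \o phi \o param M i.
have swp v w : 'D_w ('D_v F) (coord M i x) = 'D_v ('D_w F) (coord M i x).
  have swp1 b c j : ('D_b ('D_c F) (coord M i x)) 0 j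
      = 'D_b ('D_c (fun z => F z 0 j : R^o)) (coord M i x).
    rewrite smooth_mx_at_entry; last exact: smooth_mx_at_derive.
    apply: near_eq_derive; apply: filterS (smooth_mx_at_near sF) => z sFz.
    exact: smooth_mx_at_entry.
  apply/rowP => j; have := smooth_at_swap v w (sF 0 j); rewrite -!swp1.
  exact: id.
have sII v w : bil (g i x) v (w *m A i x) = bil (g i x) w (v *m A i x).
  rewrite (second_fundamental_form v w ix kx) (second_fundamental_form w v ix kx) -/F.
  by rewrite (swp v w) (christoffel_sym gN (w *m _) (v *m _) kx).
have gs := gram_sym g ix.
apply: bil_matrixP => v w; rewrite trmx_mul gs.
transitivity (bil (g i x) v (w *m A i x)); first by rewrite /bil trmx_mul !mulmxA.
rewrite sII bil_sym // /bil mulmxA //.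
Qed.

End ShapeOperator.

Lemma shape_norm2_ge0 (R : realType) (M : manifold R 2) (N : manifold R 3)
    (g : metric M) (gN : metric N) (S : spin_structure g) (phi : M -> N)
    (xi : chart N -> M -> 'rV[R]_3) (A : chart M -> M -> 'M[R]_2) (x : M) :
  isometric_immersion g gN phi -> unit_normal gN phi xi -> shape_operator gN phi xi A ->
  0 <= shape_norm2 A x.
Proof.
move=> hphi hxi hA; rewrite /shape_norm2; set i := chart_at M x.
have ix : dom M i x by exact: mem_chart_at.
have [a ax] := gdom_cover S x.
have := shape_operator_sym hphi hxi hA ix; have := frame_gram ax ix.
set P := frame_mx a i x; set G := g i x; set B := A i x => PGP sBG.
(* As G P^T is the inverse of P, this is the matrix of A in an orthonormal frame. It is symmetric,
   so tr(A^2) = tr(C C^T) is a sum of squares. *)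
pose C := P *m (B *m G) *m P^T.
have CT : C^T = C by rewrite /C !trmx_mul trmxK -trmx_mul sBG !mulmxA.
have GPP : G *m P^T *m P = 1%:M by apply: mulmx1C; rewrite mulmxA.
have -> : \tr (B *m B) = \tr (C *m C^T).
  have -> : C *m C^T = P *m (B *m B *m (G *m P^T)).
    transitivity (P *m B *m (G *m P^T *m P) *m (B *m G *m P^T)); first by rewrite CT /C !mulmxA.
    by rewrite GPP mulmx1 !mulmxA.
  by rewrite [RHS]mxtrace_mulC -[X in _ = \tr X]mulmxA GPP mulmx1.
rewrite /mxtrace sumr_ge0 // => k _; rewrite mxE sumr_ge0 // => l _.
by rewrite [C^T _ _]mxE -expr2 sqr_ge0.
Qed.

(** * Consequences of a factorization *)

Section LocallyConstant.
Context {R : realType} {n : nat} {M : manifold R n}.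
Implicit Types (i : chart M) (x : M) (f : M -> R).

Lemma derive_eq0_near (f : 'rV[R]_n -> R^o) y :
  (\forall z \near y, differentiable f z /\ forall v, 'D_v f z = 0) ->
  \forall z \near y, f z = f y.
Proof.
move/nbhs_ballP => [e /= e0 he]; apply/nbhs_ballP; exists e => //= z yz.
pose u := z - y; pose h (t : R) := f (t *: u + y).
have hb (t : R) : 0 <= t <= 1 -> ball y e (t *: u + y).
  move=> /andP[t0 t1]; move: yz; rewrite -!ball_normE /ball_/= => yz.
  rewrite opprD addrCA subrr addr0 normrN normrZ ger0_norm //.
  by apply: le_lt_trans yz; rewrite distrC ler_piMl.
have dh (t : R) : 0 <= t <= 1 -> is_derive t 1 (h : R -> R^o) 0.
  move=> /hb /he [df D0]; rewrite -(D0 u).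
  exact: derivative_along_line.
have [] := @MVT R h (fun=> 0) 0 1 ltr01.
- by move=> t; rewrite in_itv /= => /andP[t0 t1]; apply: dh; rewrite !ltW.
- apply: derivable_within_continuous => t; rewrite in_itv /= => ht.
  by have [] := dh t ht.
move=> t _; rewrite mul0r => /subr0_eq.
by rewrite /h scale1r scale0r add0r /u subrK.
Qed.

Lemma pdiff_eq0_near i x (W : set M) f : open W -> W x -> dom M i x ->
  (forall y, W y -> dom M i y -> smooth_at (coord M i y) (fun z => f (param M i z))) ->
  (forall y v, W y -> dom M i y -> pdiff i (f : M -> R^o) v y = 0) ->
  \forall y \near x, f y = f x.
Proof.
move=> oW Wx ix sf df0.
have nU : \forall y \near x, W y /\ dom M i y.
  by apply: filterI; [exact: open_nbhs_nbhs | exact: near_dom].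
have nc : \forall z \near coord M i x, f (param M i z) = f (param M i (coord M i x)).
  apply: (derive_eq0_near (f := fun z => f (param M i z))).
  apply: filterS2 (near_param ix nU) (near_coordK ix) => z [Wz iz] zK.
  split; first by have := sf _ Wz iz; rewrite zK; exact: smooth_at_differentiable.
  by move=> v; have := df0 _ v Wz iz; rewrite /pdiff zK.
have nx : \forall y \near x, f (param M i (coord M i y)) = f (param M i (coord M i x)).
  have cc : {for x, continuous (coord M i)} by exact: Defs.coord_continuous.
  exact: (cc [set z | f (param M i z) = f (param M i (coord M i x))] nc).
by apply: filterS2 nx (near_dom ix) => y hy iy; move: hy; rewrite !coordK.
Qed.

Lemma pdiff_eq0_constant (W : set M) f : open W -> connected W ->
  (forall i y, W y -> dom M i y -> smooth_at (coord M i y) (fun z => f (param M i z))) ->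
  (forall i y v, W y -> dom M i y -> pdiff i (f : M -> R^o) v y = 0) ->
  forall x y, W x -> W y -> f x = f y.
Proof.
move=> oW cW sf df0 x y Wx Wy.
have loc z : W z -> \forall t \near z, f t = f z.
  move=> Wz; have iz := mem_chart_at z.
  by apply: (pdiff_eq0_near oW Wz iz) => *; [exact: sf | exact: df0].
(* Local constancy makes every preimage open in [W]; a level set and its complement in [W] are both
   of this kind, so the level set is relatively clopen. *)
have oP (P : set R) : open [set z | W z /\ P (f z)].
  rewrite openE => z [Wz Pz]; rewrite /interior.
  have nW : \forall t \near z, W t by exact: open_nbhs_nbhs.
  by apply: filterS2 nW (loc z Wz) => t Wt ft; split=> //; rewrite ft.
have BW : [set z | W z /\ f z = f x] = W.
  apply: cW; first by exists x.
    exists [set z | W z /\ f z = f x]; first exact: (oP [set r | r = f x]).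
    by apply/seteqP; split => z; [move=> h; split=> //; case: h | case].
  exists (~` [set z | W z /\ f z <> f x]).
    by apply: open_closedC; exact: (oP [set r | r <> f x]).
  apply/seteqP; split => z.
    by move=> [Wz fz]; split => // -[_]; apply.
  by move=> [Wz nz]; split => //; apply: contrapT => h; apply: nz.
by have : W y := Wy; rewrite -{1}BW => -[_ ->].
Qed.

End LocallyConstant.

(** * Mean-curvature-normalized factorizations *)

Section Core.
Context {R : realType} {M : manifold R 2} {g : metric M} (S : spin_structure g).
Context (W : set M) (c : R) (eta : R[i]) (H nA : M -> R) (f h p q : M -> R[i]).
Hypotheses (oW : open W) (heta : 4 * eta ^+ 2 = c%:C).
Hypothesis fact : monic_factorization S W c eta H nA f h p q.
Hypothesis pH : mean_curvature_normalized W H p.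
Implicit Types (i : chart M) (a : gauge S) (x : M).

Let sR x : R := complex.Re (q x + eta).
Let sI x : R := complex.Im (q x + eta).

Lemma normalized_mean_curvature_smooth i x : W x -> dom M i x ->
  smooth_at (coord M i x) (fun z => H (param M i z)).
Proof.
move=> Wx ix; have [[_ _ sp _] _] := fact.
have [spR _] := smooth_cfun_at oW sp Wx ix.
have nW : \forall y \near x, W y by exact: open_nbhs_nbhs.
apply: smooth_at_near_eq (smooth_atN spR).
by apply: filterS (near_param ix nW) => z Wz; rewrite pH //= opprK.
Qed.

Lemma s_smooth i x : W x -> dom M i x ->
  csmooth_at (coord M i x) (fun z => q (param M i z) + eta).
Proof.
move=> Wx ix; have [[_ _ _ sq] _] := fact.
by apply: csmooth_atD; [exact: (smooth_cfun_at oW sq) | exact: csmooth_at_cst].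
Qed.

(** The constant [eta] does not affect derivatives, and since p = - H is real, the imaginary parts
    of the two coefficient equations annihilate the differential of Im s. *)
Lemma cauchy_riemann i a x : W x -> dom M i x -> gdom a x ->
  let d (k : M -> R) l := pdiff i (k : M -> R^o) (frame a l i x) x in
  [/\ d sR 0 = - d H 1, d sR 1 = d H 0, d sI 0 = 0 & d sI 1 = 0].
Proof.
move=> Wx ix ax d; have [_ _ _ _ [h0 h1]] := factorization_pointwise oW fact Wx ix ax.
have [[_ _ _ sq] _] := fact.
have sq' := smooth_cfun_at oW sq Wx ix.
have nW : \forall y \near x, W y by exact: open_nbhs_nbhs.
have sH := normalized_mean_curvature_smooth Wx ix.
have dqE l : cdiff i q (frame a l i x) x = d sR l +i* d sI l.
  rewrite -[LHS]/(cderive (frame a l i x) (fun z => q (param M i z)) (coord M i x)).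
  rewrite -[RHS]/(cderive (frame a l i x) (fun z => q (param M i z) + eta) (coord M i x)).
  rewrite (cderiveD (h := cst eta)) ?cderive_cst ?addr0 //; exact: csmooth_at_cst.
have dpE l : cdiff i p (frame a l i x) x = - (d H l)%:C.
  rewrite -[LHS]/(cderive (frame a l i x) (fun z => p (param M i z)) (coord M i x)).
  rewrite (@cderive_near_eq _ _ _ (fun z => -1 * (H (param M i z))%:C)).
    rewrite cderiveZ ?mulN1r ?cderive_real //; exact: csmooth_at_real.
  by apply: filterS (near_param ix nW) => z Wz; rewrite pH // mulN1r.
move: h0 h1; rewrite !dqE !dpE => /eqP; rewrite eq_complex /= => /andP[/eqP a1 /eqP a2].
move=> /eqP; rewrite eq_complex /= => /andP[/eqP b1 /eqP b2].
split; [by rewrite b1 | by apply: oppr_inj; rewrite a1 | by rewrite -b2 oppr0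
  | by apply: oppr_inj; rewrite -a2].
Qed.

Lemma grad_sR i x : W x -> dom M i x -> grad g i sR x = grad g i H x *m quarter_turn g i x.
Proof.
move=> Wx ix; have [a ax] := gdom_cover S x; have [r0 r1 _ _] := cauchy_riemann Wx ix ax.
apply: (grad_quarter_turn ax ix) => //; first exact: normalized_mean_curvature_smooth.
by have [] := s_smooth Wx ix.
Qed.

(** The converse relation, from J^2 = -1: it exhibits H itself as a rotated gradient, which is what
    its harmonicity requires. *)
Lemma grad_H i x : W x -> dom M i x ->
  grad g i H x = grad g i (fun y => - sR y) x *m quarter_turn g i x.
Proof.
move=> Wx ix; have [a ax] := gdom_cover S x; have [r0 r1 _ _] := cauchy_riemann Wx ix ax.
have [ssR _] := s_smooth Wx ix.
have dN v : pdiff i ((fun y => - sR y) : M -> R^o) v x = - pdiff i (sR : M -> R^o) v x.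
  exact: (smooth_at_deriveN v ssR).
apply: (grad_quarter_turn ax ix); rewrite ?dN ?r0 ?r1 ?opprK //.
  exact: smooth_atN.
exact: normalized_mean_curvature_smooth.
Qed.

(** The vanishing gradient is written as a rotated gradient, parallel to the case of Re s, so that
    harmonicity and the complex identity treat both parts alike. *)
Lemma grad_sI i x : W x -> dom M i x ->
  grad g i sI x = grad g i (fun=> 0) x *m quarter_turn g i x.
Proof.
move=> Wx ix; have [a ax] := gdom_cover S x; have [_ _ r2 r3] := cauchy_riemann Wx ix ax.
have d0 v : pdiff i ((fun=> 0) : M -> R^o) v x = 0 by exact: derive_cst.
apply: (grad_quarter_turn ax ix); rewrite ?d0 ?r2 ?r3 ?oppr0 //.
  exact: smooth_at_cst.
by have [] := s_smooth Wx ix.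
Qed.

Lemma normalized_cgrad i x : W x -> dom M i x ->
  cgrad g i (fun x => q x + eta) x
  = cgrad g i (fun y => (H y)%:C) x *m map_mx (real_complex R) (quarter_turn g i x).
Proof.
move=> Wx ix; apply/rowP => k; rewrite mxE [RHS]mxE.
rewrite -/(sR) -/(sI) grad_sR // grad_sI // !mxE.
transitivity (\sum_l (grad g i H x 0 l +i* grad g i (fun=> 0) x 0 l)
    * (quarter_turn g i x l k)%:C); last first.
  by apply: eq_bigr => l _; rewrite !mxE.
move: (quarter_turn g i x) (grad g i H x) (grad g i _ x) => J u v.
rewrite !sum_I2; apply/eqP; rewrite eq_complex /=; apply/andP; split; apply/eqP; ring.
Qed.

(** With f = H, p = - H and h = q + 2 eta the scalar coefficient gives q^2 + 2 eta q = 2 c - |A|^2;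
    adding eta^2 = c/4 completes the square. *)
Lemma normalized_square x : W x -> (q x + eta) ^+ 2 = (9 * c / 4 - nA x)%:C.
Proof.
move=> Wx; have [a ax] := gdom_cover S x; have ix := mem_chart_at x.
have [pf hq e1 _ _] := factorization_pointwise oW fact Wx ix ax.
have fE : f x = (H x)%:C.
  by move: pf; rewrite pH // => /eqP; rewrite addrC subr_eq0 => /eqP.
have n4 : (4 : R[i]) != 0 by rewrite pnatr_eq0.
have etaE : eta ^+ 2 = (c / 4)%:C.
  apply: (mulfI n4); rewrite heta -[4](rmorph_nat (real_complex R)) -rmorphM /=.
  by congr (_%:C); rewrite mulrC divfK // pnatr_eq0.
move: e1; rewrite fE pH // hq.
have -> : (nA x - H x ^+ 2 - 2 * c)%:C = (nA x)%:C - (H x)%:C ^+ 2 - 2 * c%:C :> R[i].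
  by rewrite !rmorphB rmorphXn rmorphM rmorph_nat.
have -> : (9 * c / 4 - nA x)%:C = 2 * c%:C + (c / 4)%:C - (nA x)%:C :> R[i].
  rewrite -[2](rmorph_nat (real_complex R)) -rmorphM -rmorphD -rmorphB /=.
  by congr (_%:C); field.
rewrite -etaE => /eqP; rewrite -subr_eq0 => /eqP e1.
by apply/eqP; rewrite -subr_eq0; apply/eqP; rewrite -[RHS]oppr0 -e1; ring.
Qed.

Lemma normalized_harmonic : harmonic_on g W H /\ charmonic_on g W (fun x => q x + eta).
Proof.
have hrm (k l : M -> R) :
    (forall i x, W x -> dom M i x -> smooth_at (coord M i x) (fun z => k (param M i z))) ->
    (forall i x, W x -> dom M i x -> grad g i l x = grad g i k x *m quarter_turn g i x) ->
    harmonic_on g W l.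
  move=> sk kl i x Wx ix; have [a ax] := gdom_cover S x.
  apply: (laplacian_rot_grad oW Wx ax ix (sk i x Wx ix)) => y Wy _ iy; exact: kl.
split; [|split].
- apply: (hrm (fun y => - sR y)) => [i x Wx ix|]; last exact: grad_H.
  by apply: smooth_atN; have [] := s_smooth Wx ix.
- apply: (hrm H) => [i x Wx ix|]; last exact: grad_sR.
  exact: normalized_mean_curvature_smooth.
- by apply: (hrm (fun=> 0)) => [i x Wx ix|]; [exact: smooth_at_cst | exact: grad_sI].
Qed.

Hypothesis cW : connected W.
Hypothesis nA0 : forall x, W x -> 0 <= nA x.

Lemma pdiff_frame_eq0 i a x (k : M -> R) v : W x -> dom M i x -> gdom a x ->
  smooth_at (coord M i x) (fun z => k (param M i z)) ->
  pdiff i (k : M -> R^o) (frame a 0 i x) x = 0 ->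
  pdiff i (k : M -> R^o) (frame a 1 i x) x = 0 -> pdiff i (k : M -> R^o) v x = 0.
Proof.
move=> Wx ix ax sk; rewrite !(pdiff_differential _ sk) => h0 h1.
suff -> : differential i k x = 0 by rewrite big1 // => l _; rewrite mxE mulr0.
have uP := frame_mx_unit ax ix.
have uPT : (frame_mx a i x)^T \in unitmx by rewrite unitmx_tr.
rewrite -[differential _ _ _](mulmxK uPT) [X in X *m _](_ : _ = 0) ?mul0mx //.
apply: row2P; rewrite mxE [RHS]mxE.
  by rewrite -[RHS]h0; apply: eq_bigr => l _; rewrite !mxE mulrC.
by rewrite -[RHS]h1; apply: eq_bigr => l _; rewrite !mxE mulrC.
Qed.

(** The Cauchy-Riemann equations express both frame derivatives of H through those of Re s, so H is
    locally constant on a connected set. *)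
Lemma normalized_constant : (forall x, W x -> sR x = 0) -> ~ nonconstant_on W H.
Proof.
move=> s0 [x [y [Wx Wy]]]; apply.
apply: (pdiff_eq0_constant oW cW) => // i z => [|v] Wz iz.
  exact: normalized_mean_curvature_smooth.
have [a az] := gdom_cover S z; have [r0 r1 _ _] := cauchy_riemann Wz iz az.
have d0 v' : pdiff i (sR : M -> R^o) v' z = 0.
  have nW : \forall t \near z, W t by exact: open_nbhs_nbhs.
  rewrite /pdiff (@near_eq_derive _ _ _ _ (cst 0)) ?derive_cst //.
  by apply: filterS (near_param iz nW) => t; exact: s0.
apply: (pdiff_frame_eq0 v Wz iz az); first exact: normalized_mean_curvature_smooth.
  by rewrite -r1 d0.
by apply: oppr_inj; rewrite -r0 d0 oppr0.
Qed.

Lemma normalized_nonconstant : nonconstant_on W H ->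
  [/\ forall x, W x -> sI x = 0, 0 < c & forall x, W x -> nA x <= 9 * c / 4].
Proof.
move=> ncH.
have sq x : W x -> sR x ^+ 2 - sI x ^+ 2 = 9 * c / 4 - nA x /\ 2 * (sR x * sI x) = 0.
  move=> /normalized_square /eqP; rewrite eq_complex => /andP[/eqP e1 /eqP e2].
  rewrite /sR /sI; move: e1 e2; case: (q x + eta) => u v /= <- e2.
  by split; [ring | rewrite -e2; ring].
have sIc x y : W x -> W y -> sI x = sI y.
  apply: (pdiff_eq0_constant oW cW) => i z => [|v] Wz iz.
    by have [] := s_smooth Wz iz.
  have [a az] := gdom_cover S z; have [_ _ r2 r3] := cauchy_riemann Wz iz az.
  by apply: (pdiff_frame_eq0 v Wz iz az); have [] := s_smooth Wz iz.
have sI0 x : W x -> sI x = 0.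
  move=> Wx; apply: contrapT => /eqP nz; apply: normalized_constant ncH => y Wy.
  have [_ /eqP] := sq y Wy; rewrite !mulf_eq0 pnatr_eq0 /= (sIc y x Wy Wx) (negbTE nz) orbF.
  by move/eqP.
have sR2 x : W x -> sR x ^+ 2 = 9 * c / 4 - nA x.
  by move=> Wx; have [<- _] := sq x Wx; rewrite sI0 // expr0n subr0.
split => // [|x Wx]; last by rewrite -subr_ge0 -sR2 // sqr_ge0.
(* If c <= 0, then (Re s)^2 = 9 c / 4 - |A|^2 is at most 0, so Re s vanishes identically. *)
rewrite ltNge; apply/negP => c0; apply: normalized_constant ncH => y Wy.
apply/eqP; rewrite -sqrf_eq0; apply/eqP; apply: le_anti; rewrite sqr_ge0 andbT.
by rewrite sR2 //; have := nA0 Wy; lra.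
Qed.

End Core.

(** With f = - p and h = q + 2 eta the products p q cancel in the omega coefficient, which becomes 2
    eta (p + H); a nonzero [eta] can be divided out. *)
Lemma monic_factorization_normalized (R : realType) (M : manifold R 2) (g : metric M)
    (S : spin_structure g) (W : set M) (c : R) (eta : R[i]) (H nA : M -> R)
    (f h p q : M -> R[i]) :
  open W -> eta != 0 -> monic_factorization S W c eta H nA f h p q ->
  mean_curvature_normalized W H p.
Proof.
move=> oW eta0 fact x Wx; have [a ax] := gdom_cover S x; have ix := mem_chart_at x.
have [pf hq _ e2 _] := factorization_pointwise oW fact Wx ix ax.
have n2e : 2 * eta != 0 by rewrite mulf_neq0 // pnatr_eq0.
apply/eqP; rewrite -addr_eq0 -(inj_eq (mulfI n2e)) mulr0; apply/eqP.
have fE : f x = - p x by apply/eqP; rewrite -addr_eq0 addrC pf.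
by rewrite -e2 hq fE; ring.
Qed.

Theorem theorem8p2 (R : realType) (c : R)
    (N : manifold R 3) (gN : metric N) (hN : space_form gN c)
    (M : manifold R 2) (g : metric M) (S : spin_structure g)
    (phi : M -> N) (hphi : isometric_immersion g gN phi)
    (xi : chart N -> M -> 'rV[R]_3) (hxi : unit_normal gN phi xi)
    (A : chart M -> M -> 'M[R]_2) (hA : shape_operator gN phi xi A)
    (eta : R[i]) (heta : 4 * eta ^+ 2 = c%:C)
    (Omega : set M) (hopen : open Omega) (hconn : connected Omega) :
  let H := mean_curvature A in
  let nA := shape_norm2 A in
  let factors := monic_factorization S Omega c eta H nA in
  (forall beta : M -> R[i], smooth_cfun Omega beta ->
     factors (fun x => (H x)%:C) (fun x => beta x + 2 * eta)
             (fun x => - (H x)%:C) beta ->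
     let s := fun x => beta x + eta in
     let disc := fun x => 9 * c - 4 * nA x in
     [/\ forall i x, Omega x -> dom M i x ->
           cgrad g i s x
           = cgrad g i (fun y => (H y)%:C) x
               *m map_mx (real_complex R) (quarter_turn g i x),
         forall x, Omega x ->
           s x ^+ 2 = (disc x / 4)%:C /\ disc x / 4 = 9 * c / 4 - nA x,
         harmonic_on g Omega H,
         charmonic_on g Omega s &
         nonconstant_on Omega H ->
           [/\ forall x, Omega x -> complex.Im (s x) = 0,
               0 < c &
               forall x, Omega x -> nA x <= 9 * c / 4]])
  /\ (c = 0 \/ c < 0 -> nonconstant_on Omega H ->
      ~ exists f h p q : M -> R[i],
          factors f h p q /\ mean_curvature_normalized Omega H p)
  /\ (c < 0 -> nonconstant_on Omega H ->
      ~ exists f h p q : M -> R[i], factors f h p q).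
Proof.
move=> H nA factors; have nA0 x : 0 <= nA x by exact: shape_norm2_ge0 hphi hxi hA.
have no_normalized : c = 0 \/ c < 0 -> nonconstant_on Omega H ->
    ~ exists f h p q : M -> R[i], factors f h p q /\ mean_curvature_normalized Omega H p.
  move=> c0 nc [f [h [p [q [fact pH]]]]].
  have [_ + _] := normalized_nonconstant hopen heta fact pH hconn (fun x _ => nA0 x) nc.
  by case: c0 => [->|c0]; [rewrite ltxx | rewrite ltNge (ltW c0)].
split; [|split=> //].
- move=> beta _ fact s disc.
  have pH : mean_curvature_normalized Omega H (fun x => - (H x)%:C) by [].
  have [hH hs] := normalized_harmonic hopen fact pH.
  split => //.
  + by move=> i x; exact: (normalized_cgrad hopen fact pH).
  + move=> x Ox; have dE : disc x / 4 = 9 * c / 4 - nA x by rewrite /disc; field.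
    by split => //; rewrite dE; exact: (normalized_square hopen heta fact pH).
  + exact: (normalized_nonconstant hopen heta fact pH hconn (fun x _ => nA0 x)).
- move=> c0 nc [f [h [p [q fact]]]]; apply: no_normalized nc _; first by right.
  exists f, h, p, q; split=> //.
  apply: (monic_factorization_normalized hopen _ fact).
  (* For c < 0 the relation 4 eta^2 = c excludes eta = 0. *)
  apply/eqP => eta0; move: heta; rewrite eta0 expr0n mulr0 => /eqP.
  by rewrite eq_sym eq_complex /= lt_eqF.
Qed.
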